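(* Let $\phi:G\to H$ be a hypercover between Lie groupoids and let $V\to H$ be a higher vector bundle. Then $\phi^*:C_{lin}(V)\to C_{lin}(\phi^*V)$ is a quasi-isomorphism.
   Context: A Lie groupoid $G$ is identified with its nerve, the simplicial manifold whose $n$-simplices $G_n$ are chains of $n$ composable arrows. A Lie groupoid morphism $\phi:G\to H$ is a hypercover if $\phi_0:G_0\to H_0$ is a surjective submersion and the square with sides $\phi_1:G_1\to H_1$, $\phi_0\times\phi_0:G_0\times G_0\to H_0\times H_0$ and the two maps (target, source) is cartesian, i.e. $G_1\to(G_0\times G_0)\times_{H_0\times H_0}H_1$ is a diffeomorphism. For simplicial manifolds $X,Y$, a map $f:X\to Y$ and an inclusion $K\to L$ of finite simplicial sets, $X^K=\hom(K,X)$, and $X^K\times_{Y^K}Y^L$ is the space of pairs of maps $\phi:K\to X$, $\psi:L\to Y$ with $f\phi=\psi|_K$. It is smooth if this limit exists in manifolds with the topology of the limit in topological spaces; concretely, if $K$ is spanned by simplices $\sigma_i\in K_{n_i}$ and $L$ by the $\sigma_i$ and $\tau_j\in L_{n_j}\setminus K$ (finitely many), this means that $(\phi,\psi)\mapsto((\phi(\sigma_i))_i,(\psi(\tau_j))_j)$ identifies it with an embedded submanifold of $\prod_iX_{n_i}\times\prod_jY_{n_j}$. The map $f$ is a fibration if for all $n\ge0$ and $0\le k\le n$ the relative horn space $X^{\Lambda^n_k}\times_{Y^{\Lambda^n_k}}Y_n$ is smooth and the restriction map $X_n\to X^{\Lambda^n_k}\times_{Y^{\Lambda^n_k}}Y_n$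 is a surjective submersion (with $\Lambda^0_0=\emptyset$). A higher vector bundle $V\to H$ over a Lie groupoid $H$ is a simplicial vector bundle over the nerve of $H$ (each $V_n\to H_n$ is a smooth finite rank real vector bundle and all faces and degeneracies of $V$ are linear over those of $H$) such that $V\to H$ is also a fibration of simplicial manifolds. The pullback $\phi^*V\to G$ has $(\phi^*V)_n=\phi_n^*V_n=G_n\times_{H_n}V_n$ with the induced simplicial structure. $C_{lin}(V)$ is the cochain complex with $C^n_{lin}(V)$ the space of smooth fiberwise linear functions on $V_n$ and differential, up to a sign depending only on the degree, $\sum_{i=0}^{n+1}(-1)^ic\circ d_i$. The map $\phi^*:C_{lin}(V)\to C_{lin}(\phi^*V)$ is composition with the canonical projections $(\phi^*V)_n\to V_n$. *)

(* Defs.v *)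
From HB Require Import structures.
From mathcomp Require Import all_boot all_order all_algebra.
From mathcomp Require Import all_classical all_reals all_analysis.

Set Implicit Arguments.
Unset Strict Implicit.
Unset Printing Implicit Defensive.

Import Order.TTheory GRing.Theory Num.Theory numFieldNormedType.Exports.

Local Open Scope classical_set_scope.
Local Open Scope ring_scope.

(* [U] is meant to be open, so that ['D_v f] on [U] only depends on [f] on
   [U]. *)
Fixpoint Ck (R : realType) (n k : nat) (U : set 'rV[R]_n) (f : 'rV[R]_n -> R) :
    Prop :=
  match k with
  | 0 => forall x, U x -> {for x, continuous f}
  | k'.+1 => (forall x, U x -> differentiable f x) /\
             (forall v, Ck k' U (fun x => 'D_v f x))
  end.

Definition smooth_near (R : realType) (n : nat) (x : 'rV[R]_n)
    (f : 'rV[R]_n -> R) : Prop :=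
  exists U : set 'rV[R]_n, [/\ open U, U x & forall k, Ck k U f].

Lemma near_eq_continuous (T S : topologicalType) (f g : T -> S) (x : T) :
  (\forall y \near x, f y = g y) -> {for x, continuous f} ->
  {for x, continuous g}.
Proof.
move=> fg cf; rewrite /prop_for /continuous_at -(nbhs_singleton fg).
by apply: cvg_trans cf; apply: near_eq_cvg.
Qed.

Lemma near_eq_differentiable (R : realType) (V W : normedModType R)
    (f g : V -> W) (x : V) :
  (\forall y \near x, f y = g y) -> differentiable f x -> differentiable g x.
Proof.
move=> fg /diff_locallyP[dc df].
have dg : g \o shift x = cst (g x) + 'd f x +o_ 0 id.
  apply/eqaddoP => e e0; move/eqaddoP : df => /(_ e e0) df.
  have fg0 : \forall y \near (0 : V), f (y + x) = g (y + x).
    by move: fg; rewrite (near_shift 0 x) => fg; apply: filterS fg => y /=; rewrite subr0.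
  apply: filterS2 fg0 df => y /= Ey.
  by rewrite !fctE /= (nbhs_singleton fg) Ey.
have E := diff_unique dc dg.
by apply/diff_locallyP; split; rewrite E.
Qed.

Lemma Ck_ext (R : realType) n k (U V : set 'rV[R]_n) (f g : 'rV[R]_n -> R) :
  open V -> V `<=` U -> (forall x, V x -> f x = g x) -> Ck k U f -> Ck k V g.
Proof.
move=> oV VU; elim: k f g => [|k IH] f g fg /=.
  move=> cf x Vx; apply: near_eq_continuous (cf x (VU _ Vx)).
  exact: filterS fg (open_nbhs_nbhs (conj oV Vx)).
have E x : V x -> \forall y \near x, f y = g y.
  by move=> Vx; exact: filterS fg (open_nbhs_nbhs (conj oV Vx)).
case=> df Df; split=> [x Vx|v].
  exact: (near_eq_differentiable (E x Vx)) (df x (VU _ Vx)).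
apply: IH (Df v) => x Vx; apply: near_eq_derive; exact: E.
Qed.

(* A topological space with a sheaf of continuous real functions, given by its
   germs: [smooth_at x f] says that [f] restricts to a section on some
   neighbourhood of [x], so that the sections over an open set [U] are the
   functions [f] with [smooth_at x f] for all [x] in [U]. Manifolds are the
   spaces locally isomorphic to R^n with its sheaf of smooth functions. All
   subsets, products and fibre products of manifolds carry such a sheaf, and
   that one of them is smooth is the property of being a manifold. *)
Record smooth_space (R : realType) := SmoothSpace {
  space :> topologicalType;
  smooth_at : space -> (space -> R) -> Prop;
  smooth_at_local : forall x f g,
    (\forall y \near x, f y = g y) -> smooth_at x f -> smooth_at x g;
  smooth_at_open : forall x f,
    smooth_at x f -> \forall y \near x, smooth_at y f;
  smooth_at_continuous : forall x f, smooth_at x f -> {for x, continuous f}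
}.
Arguments smooth_at {R s} x f.

Section Euclidean.
Variables (R : realType) (n : nat).

Lemma smooth_near_local (x : 'rV[R]_n) f g :
  (\forall y \near x, f y = g y) -> smooth_near x f -> smooth_near x g.
Proof.
rewrite /prop_near1 nbhsE => -[V [oV Vx] fg] [U [oU Ux sU]].
exists (U `&` V); split; [exact: openI | by split | move=> k].
by apply: Ck_ext (sU k) => [||y []]; [exact: openI | exact: subIsetl | move=> _ /fg].
Qed.

Lemma smooth_near_open (x : 'rV[R]_n) f :
  smooth_near x f -> \forall y \near x, smooth_near y f.
Proof.
move=> [U [oU Ux sU]]; rewrite /prop_near1 nbhsE; exists U => // y Uy.
by exists U.
Qed.

Lemma smooth_near_continuous (x : 'rV[R]_n) f :
  smooth_near x f -> {for x, continuous f}.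
Proof. by move=> [U [_ Ux /(_ 0%N)]]; apply. Qed.

Definition euclidean : smooth_space R :=
  SmoothSpace smooth_near_local smooth_near_open smooth_near_continuous.

End Euclidean.

Definition smooth_map_at (R : realType) (M N : smooth_space R) (f : M -> N)
    (x : M) : Prop :=
  {for x, continuous f} /\
  (forall g : N -> R, smooth_at (f x) g -> smooth_at x (g \o f)).

Definition smooth_map (R : realType) (M N : smooth_space R) (f : M -> N) : Prop :=
  forall x, smooth_map_at f x.

Definition smooth_function (R : realType) (M : smooth_space R) (f : M -> R) :
    Prop :=
  forall x, smooth_at x f.

(* [f] restricts to a diffeomorphism from [U] onto [V], with inverse [g]; the
   values of [f] outside [U] and of [g] outside [V] are irrelevant. *)
Definition diffeo_on (R : realType) (M N : smooth_space R) (U : set M)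
    (V : set N) (f : M -> N) (g : N -> M) : Prop :=
  [/\ open U, open V,
      forall x, U x -> [/\ V (f x), g (f x) = x & smooth_map_at f x] &
      forall y, V y -> [/\ U (g y), f (g y) = y & smooth_map_at g y]].

Definition diffeomorphism (R : realType) (M N : smooth_space R) (f : M -> N) :
    Prop :=
  exists g : N -> M, diffeo_on [set: M] [set: N] f g.

Definition chart_at (R : realType) (M : smooth_space R) (n : nat) (x : M)
    (phi : M -> 'rV[R]_n) (psi : 'rV[R]_n -> M) : Prop :=
  exists (U : set M) (V : set (euclidean R n)),
    U x /\ diffeo_on (N := euclidean R n) U V phi psi.

(* The dimension is locally constant, but may depend on the component. *)
Definition manifold (R : realType) (M : smooth_space R) : Prop :=
  [/\ hausdorff_space M, @second_countable M &
      forall x : M, exists n (phi : M -> 'rV[R]_n) psi, chart_at x phi psi].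

Definition submersion (R : realType) (M N : smooth_space R) (f : M -> N) : Prop :=
  smooth_map f /\
  forall x : M, exists m n (phi : M -> 'rV[R]_m) (phi' : 'rV[R]_m -> M)
      (psi : N -> 'rV[R]_n) (psi' : 'rV[R]_n -> N),
    [/\ chart_at x phi phi', chart_at (f x) psi psi' &
        forall w, exists v, 'd (psi \o f \o phi') (phi x) v = w].

Definition surjective_submersion (R : realType) (M N : smooth_space R)
    (f : M -> N) : Prop :=
  submersion f /\ (forall y, exists x, f x = y).

Section InitialSpace.
Variables (R : realType) (T I : Type) (X : I -> smooth_space R).
Variable f : forall i, T -> X i.

(* The coarsest topology making all the [f i] continuous. *)
Definition initial_carrier : topologicalType :=
  sup_topology (fun i =>
    Topological.class (initial_topology (f i : {classic T} -> X i))).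

(* The smooth functions are locally the smooth functions of finitely many
   smooth functions pulled back along the [f i]. For an embedding into a finite
   product of manifolds these are the functions that locally extend to smooth
   functions on the product. *)
Definition initial_smooth_at (t : initial_carrier) (h : initial_carrier -> R) :
    Prop :=
  exists k (i : 'I_k -> I) (g : forall j, X (i j) -> R) (F : 'rV[R]_k -> R),
    [/\ forall j, smooth_at (f (i j) t) (g j),
        smooth_near (\row_j g j (f (i j) t)) F &
        \forall s \near t, h s = F (\row_j g j (f (i j) s))].

Lemma initial_ev_continuous i : continuous (f i : initial_carrier -> X i).
Proof.
move=> t A nA.
have /cvg_sup/(_ i) : nbhs t --> t by exact: cvg_id.
apply; exact: (@initial_continuous {classic T} (X i) (f i) t A nA).
Qed.

Lemma initial_continuous_at (M : topologicalType) (phi : M -> initial_carrier)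
    (x : M) :
  (forall i, {for x, continuous (fun y => f i (phi y))}) ->
  {for x, continuous phi}.
Proof.
move=> cphi; apply/cvg_sup => i A [_ [[B oB <-] Bx] BA].
apply: (filterS BA); apply: (cphi i); exact: open_nbhs_nbhs.
Qed.

Lemma initial_row_continuous k (i : 'I_k -> I) (g : forall j, X (i j) -> R)
    (t : initial_carrier) :
  (forall j, smooth_at (f (i j) t) (g j)) ->
  {for t, continuous (fun s : initial_carrier => \row_j g j (f (i j) s))}.
Proof.
move=> sg A [P tP PA].
have FF : Filter (nbhs t) by exact: nbhs_filter.
have H a j : \forall s \near t, P a j (g j (f (i j) s)).
  have := tP a j; rewrite mxE => Pj.
  have cg : {for t, continuous (g j \o (f (i j) : initial_carrier -> X (i j)))}.
    apply: continuous_comp; first exact: initial_ev_continuous.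
    exact: smooth_at_continuous.
  exact: cg Pj.
have := filter_forall FF (fun a => filter_forall FF (H a)).
by apply: filterS => s Hs; apply: PA => a j /=; rewrite mxE.
Qed.

Lemma initial_smooth_at_local (t : initial_carrier) h h' :
  (\forall s \near t, h s = h' s) -> initial_smooth_at t h ->
  initial_smooth_at t h'.
Proof.
move=> hh' [k [i [g [F [sg sF hF]]]]]; exists k, i, g, F; split => //.
by apply: filterS2 hh' hF => s ->.
Qed.

Lemma initial_smooth_at_open (t : initial_carrier) h :
  initial_smooth_at t h -> \forall s \near t, initial_smooth_at s h.
Proof.
move=> [k [i [g [F [sg sF hF]]]]].
have sg' : \forall s \near t, forall j, smooth_at (f (i j) s) (g j).
  apply: (filter_forall (nbhs_filter t)) => j.
  exact: (@initial_ev_continuous (i j) t _ (smooth_at_open (sg j))).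
have sF' := initial_row_continuous sg (smooth_near_open sF).
have hF' : \forall s \near t, \forall s' \near s,
  h s' = F (\row_j g j (f (i j) s')) by exact: nbhs_interior.
apply: filterS3 sg' sF' hF' => s H1 H2 H3.
by exists k, i, g, F.
Qed.

Lemma initial_smooth_at_continuous (t : initial_carrier) h :
  initial_smooth_at t h -> {for t, continuous h}.
Proof.
move=> [k [i [g [F [sg sF hF]]]]].
have hF' : \forall s \near t, F (\row_j g j (f (i j) s)) = h s.
  by apply: filterS hF => s ->.
apply: (near_eq_continuous hF').
exact: (continuous_comp (initial_row_continuous sg) (smooth_near_continuous sF)).
Qed.

Definition initial_space : smooth_space R :=
  SmoothSpace initial_smooth_at_local initial_smooth_at_open
    initial_smooth_at_continuous.

End InitialSpace.

(* Maps between initial spaces given on components by smooth maps. *)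
Lemma initial_smooth_map (R : realType) (T T' I I' : Type)
    (X : I -> smooth_space R) (X' : I' -> smooth_space R)
    (f : forall i, T -> X i) (f' : forall i, T' -> X' i)
    (r : I' -> I) (a : forall i', X (r i') -> X' i')
    (phi : initial_space f -> initial_space f') :
  (forall i', smooth_map (a i')) ->
  (forall i' t, f' i' (phi t) = a i' (f (r i') t)) -> smooth_map phi.
Proof.
move=> sa E t.
have cphi : {for t, continuous phi}.
  apply: initial_continuous_at => i'.
  have -> : (fun s => f' i' (phi s)) = a i' \o f (r i').
    by apply/funext => s; rewrite E.
  exact: continuous_comp (@initial_ev_continuous _ _ _ _ f _ _) (proj1 (sa i' _)).
split=> // h [k [i' [g [F [sg sF hF]]]]].
exists k, (fun j => r (i' j)), (fun j => g j \o a (i' j)), F; split.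
- by move=> j; apply: (proj2 (sa (i' j) _)); rewrite -E.
- have <- : \row_j g j (f' (i' j) (phi t)) =
            \row_j (g j \o a (i' j)) (f (r (i' j)) t) => //.
  by apply/rowP => j; rewrite !mxE /= E.
- have := cphi _ hF; apply: (@filterS _ _ (nbhs_filter t)) => s /= ->; congr F.
  by apply/rowP => j; rewrite !mxE /= E.
Qed.

Definition two_spaces (R : realType) (M N : smooth_space R) (b : bool) :=
  if b then M else N.

Definition two_maps (R : realType) (T : Type) (M N : smooth_space R)
    (p : T -> M) (q : T -> N) (b : bool) : T -> two_spaces M N b :=
  match b with true => p | false => q end.

Definition prod_space (R : realType) (M N : smooth_space R) : smooth_space R :=
  initial_space (two_maps (fun x : M * N => x.1) (fun x : M * N => x.2)).

Definition fib_space (R : realType) (M N B : smooth_space R)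
    (f : M -> B) (g : N -> B) : smooth_space R :=
  initial_space (two_maps (fun x : {p : M * N | f p.1 = g p.2} => (sval x).1)
                          (fun x : {p : M * N | f p.1 = g p.2} => (sval x).2)).

Lemma sval_inj (T : Type) (P : T -> Prop) : injective (@sval T P).
Proof. by move=> [x px] [y py] /= xy; exact: eq_exist. Qed.

Notation Delta m n := {omorphism 'I_m.+1 -> 'I_n.+1}.

Definition face_fun n (i : 'I_n.+2) : 'I_n.+1 -> 'I_n.+2 := lift i.

Lemma face_homo n (i : 'I_n.+2) : {homo face_fun i : j k / (j <= k)%O}.
Proof. by move=> j k; rewrite !leEord /= leq_bump2. Qed.

HB.instance Definition _ n (i : 'I_n.+2) :=
  Order.isOrderMorphism.Build _ 'I_n.+1 _ 'I_n.+2 (face_fun i) (@face_homo n i).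

Definition coface n (i : 'I_n.+2) : Delta n n.+1 := face_fun i.
Definition ocomp l m n (a : Delta m n) (b : Delta l m) : Delta l n := a \o b.
Definition oid n : Delta n n := idfun.

Record simplicial_space (R : realType) := SimplicialSpace {
  simplices :> nat -> smooth_space R;
  act : forall m n, Delta m n -> simplices n -> simplices m;
  act_smooth : forall m n (a : Delta m n), smooth_map (act a);
  act_id : forall n x, act (oid n) x = x;
  act_comp : forall l m n (a : Delta m n) (b : Delta l m) x,
    act (ocomp a b) x = act b (act a x)
}.

Definition simplicial_manifold (R : realType) (X : simplicial_space R) : Prop :=
  forall n, manifold (X n).

Record simplicial_map (R : realType) (X Y : simplicial_space R) := SimplicialMap {
  smap :> forall n, X n -> Y n;
  smap_smooth : forall n, smooth_map (@smap n);
  smap_act : forall m n (a : Delta m n) x, smap (act a x) = act a (smap x)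
}.

(* The [m]-simplices of the horn: the monotone maps [m] -> [n] whose image
   misses some vertex other than [k]. For [n = 0] there are none. *)
Definition in_horn n (k : 'I_n.+1) m (a : Delta m n) : Prop :=
  exists2 j : 'I_n.+1, j != k & forall i, a i != j.

Section RelativeHorn.
Variables (R : realType) (X Y : simplicial_space R) (f : simplicial_map X Y).
Variables (n : nat) (k : 'I_n.+1).

(* A simplicial map from the horn to [X] and a compatible [n]-simplex of [Y]. *)
Record horn_pair := HornPair {
  horn_map : forall m (a : Delta m n), in_horn k a -> X m;
  horn_filler : Y n;
  horn_map_act : forall l m (a : Delta m n) (b : Delta l m)
    (ha : in_horn k a) (hab : in_horn k (ocomp a b)),
    horn_map hab = act b (horn_map ha);
  horn_compat : forall m (a : Delta m n) (ha : in_horn k a),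
    f m (horn_map ha) = act a horn_filler
}.

(* The topology and smooth structure of the limit: the initial ones for the
   values at the simplices of the horn and the [n]-simplex of [Y]. All of them
   are smooth functions of those on finitely many spanning simplices, so that
   [relative_horn] is a manifold exactly when it is embedded as a submanifold
   in the product over a finite spanning family. *)
Definition horn_index := option {m : nat & {a : Delta m n | in_horn k a}}.
Definition horn_value (i : horn_index) : smooth_space R :=
  match i with Some s => X (tag s) | None => Y n end.
Definition horn_ev (i : horn_index) : horn_pair -> horn_value i :=
  match i with
  | Some s => fun p => horn_map p (svalP (tagged s))
  | None => fun p => horn_filler p
  end.
Definition relative_horn : smooth_space R := initial_space horn_ev.

Lemma in_horn_comp l m (a : Delta m n) (b : Delta l m) :
  in_horn k a -> in_horn k (ocomp a b).
Proof. by case=> j jk aj; exists j => // i; exact: aj. Qed.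

Definition horn_restriction (x : X n) : relative_horn :=
  @HornPair (fun m a _ => act a x) (f n x)
    (fun l m a b _ _ => act_comp a b x) (fun m a _ => smap_act f a x).

End RelativeHorn.

Definition fibration (R : realType) (X Y : simplicial_space R)
    (f : simplicial_map X Y) : Prop :=
  forall n (k : 'I_n.+1), manifold (relative_horn f k) /\
    surjective_submersion (@horn_restriction R X Y f n k).

Record lie_groupoid (R : realType) := LieGroupoid {
  ob : smooth_space R;
  ar : smooth_space R;
  src : ar -> ob;
  tgt : ar -> ob;
  one : ob -> ar;
  inv : ar -> ar;
  (* [comp g h] is the arrow "g after h" *)
  comp : forall g h, src g = tgt h -> ar;
  ob_manifold : manifold ob;
  ar_manifold : manifold ar;
  src_submersion : submersion src;
  tgt_submersion : submersion tgt;
  one_smooth : smooth_map one;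
  inv_smooth : smooth_map inv;
  comp_smooth : smooth_map
    (fun p : fib_space src tgt => @comp (sval p).1 (sval p).2 (svalP p));
  src_one : forall x, src (one x) = x;
  tgt_one : forall x, tgt (one x) = x;
  src_comp : forall g h (e : src g = tgt h), src (comp e) = src h;
  tgt_comp : forall g h (e : src g = tgt h), tgt (comp e) = tgt g;
  comp_one_r : forall g (e : src g = tgt (one (src g))), comp e = g;
  comp_one_l : forall g (e : src (one (tgt g)) = tgt g), comp e = g;
  comp_assoc : forall g h k (e1 : src g = tgt h) (e2 : src h = tgt k)
    (e3 : src (comp e1) = tgt k) (e4 : src g = tgt (comp e2)),
    comp e3 = comp e4;
  src_inv : forall g, src (inv g) = tgt g;
  tgt_inv : forall g, tgt (inv g) = src g;
  comp_inv_r : forall g (e : src g = tgt (inv g)), comp e = one (tgt g);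
  comp_inv_l : forall g (e : src (inv g) = tgt g), comp e = one (src g)
}.

Section Nerve.
Variables (R : realType) (G : lie_groupoid R).

(* A chain x_0 -> ... -> x_n of composable arrows together with all its partial
   composites [chain_ar i j] : x_i -> x_j, that is a functor [n] -> G, so that
   monotone maps act by reindexing. *)
Record chain n := Chain {
  chain_ob : 'I_n.+1 -> ob G;
  chain_ar : forall i j : 'I_n.+1, (i <= j)%O -> ar G;
  chain_src : forall i j (ij : (i <= j)%O), src (chain_ar ij) = chain_ob i;
  chain_tgt : forall i j (ij : (i <= j)%O), tgt (chain_ar ij) = chain_ob j;
  chain_one : forall i (ii : (i <= i)%O), chain_ar ii = one (chain_ob i);
  chain_comp : forall i j k (ij : (i <= j)%O) (jk : (j <= k)%O) (ik : (i <= k)%O)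
    (e : src (chain_ar jk) = tgt (chain_ar ij)), comp e = chain_ar ik
}.

Lemma chain_eq n (c c' : chain n) :
  (forall i, chain_ob c i = chain_ob c' i) ->
  (forall i j (ij : (i <= j)%O), chain_ar c ij = chain_ar c' ij) -> c = c'.
Proof.
case: c => o a s t u m; case: c' => o' a' s' t' u' m' /= /funext eo ea.
have eaa : a = a'.
  apply: functional_extensionality_dep => i.
  by apply: functional_extensionality_dep => j; apply/funext => ij; exact: ea.
by case: _ / eo in s' t' u' m' *; case: _ / eaa in s' t' u' m' *; congr Chain;
  exact: Prop_irrelevance.
Qed.

Definition chain_index n : Type :=
  ('I_n.+1 + {p : 'I_n.+1 * 'I_n.+1 | (p.1 <= p.2)%O})%type.
Definition chain_value n (i : chain_index n) : smooth_space R :=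
  match i with inl _ => ob G | inr _ => ar G end.
Definition chain_ev n (i : chain_index n) : chain n -> chain_value i :=
  match i with
  | inl i => fun c => chain_ob c i
  | inr p => fun c => chain_ar c (svalP p)
  end.

Definition nerve_space n : smooth_space R := initial_space (@chain_ev n).

Definition nerve_act m n (a : Delta m n) (c : nerve_space n) : nerve_space m :=
  @Chain m (fun i => chain_ob c (a i))
    (fun i j ij => chain_ar c (omorph_le a ij))
    (fun i j ij => chain_src c _) (fun i j ij => chain_tgt c _)
    (fun i ii => chain_one c _) (fun i j k ij jk ik => @chain_comp _ c _ _ _ _ _ _).

Lemma nerve_act_smooth m n (a : Delta m n) : smooth_map (nerve_act a).
Proof.
pose r (i : chain_index m) : chain_index n :=
  match i with
  | inl i => inl (a i)
  | inr p => inr (exist _ (a (sval p).1, a (sval p).2) (omorph_le a (svalP p)))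
  end.
pose b (i : chain_index m) : chain_value (r i) -> chain_value i :=
  match i with inl _ => id | inr _ => id end.
apply: (@initial_smooth_map _ _ _ _ _ _ _ _ _ r b).
  by move=> [i|p] x; split=> //; exact: cvg_id.
case=> [i|p] t => //=; rewrite /chain_ev /=; congr chain_ar; exact: Prop_irrelevance.
Qed.

Lemma nerve_act_id n (c : nerve_space n) : nerve_act (oid n) c = c.
Proof.
apply: chain_eq => [//|i j ij] /=.
by congr chain_ar; exact: Prop_irrelevance.
Qed.

Lemma nerve_act_comp l m n (a : Delta m n) (b : Delta l m) (c : nerve_space n) :
  nerve_act (ocomp a b) c = nerve_act b (nerve_act a c).
Proof.
apply: chain_eq => [//|i j ij] /=.
by congr chain_ar; exact: Prop_irrelevance.
Qed.

Definition nerve : simplicial_space R :=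
  SimplicialSpace nerve_act_smooth nerve_act_id nerve_act_comp.

End Nerve.

Record lie_morphism (R : realType) (G H : lie_groupoid R) := LieMorphism {
  mob : ob G -> ob H;
  mar : ar G -> ar H;
  mob_smooth : smooth_map mob;
  mar_smooth : smooth_map mar;
  mar_src : forall g, src (mar g) = mob (src g);
  mar_tgt : forall g, tgt (mar g) = mob (tgt g);
  mar_one : forall x, mar (one x) = one (mob x);
  mar_comp : forall g h (e : src g = tgt h) (e' : src (mar g) = tgt (mar h)),
    mar (comp e) = comp e'
}.

Section NerveMap.
Variables (R : realType) (G H : lie_groupoid R) (phi : lie_morphism G H).

Definition nerve_fun n (c : nerve G n) : nerve H n.
Proof.
apply: (@Chain R H n (fun i => mob phi (chain_ob c i))
  (fun i j ij => mar phi (chain_ar c ij))).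
- by move=> i j ij; rewrite mar_src chain_src.
- by move=> i j ij; rewrite mar_tgt chain_tgt.
- by move=> i ii; rewrite chain_one mar_one.
- move=> i j k ij jk ik e.
  have e0 : src (chain_ar c jk) = tgt (chain_ar c ij).
    by rewrite chain_src chain_tgt.
  by rewrite -(mar_comp e0) (chain_comp ik).
Defined.

Lemma nerve_fun_smooth n : smooth_map (@nerve_fun n).
Proof.
pose b (i : chain_index n) : chain_value G i -> chain_value H i :=
  match i with inl _ => mob phi | inr _ => mar phi end.
apply: (@initial_smooth_map _ _ _ _ _ _ _ _ _ id b).
  by move=> [i|p]; [exact: mob_smooth | exact: mar_smooth].
by case=> [?|?] t.
Qed.

Lemma nerve_fun_act m n (a : Delta m n) (c : nerve G n) :
  nerve_fun (act a c) = act a (nerve_fun c).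
Proof. exact: chain_eq. Qed.

Definition nerve_map : simplicial_map (nerve G) (nerve H) :=
  SimplicialMap nerve_fun_smooth nerve_fun_act.

Let ends (K : lie_groupoid R) (g : ar K) : prod_space (ob K) (ob K) :=
  (tgt g, src g).
Let mob2 (x : prod_space (ob G) (ob G)) : prod_space (ob H) (ob H) :=
  (mob phi x.1, mob phi x.2).

Lemma hypercover_compat (g : ar G) : mob2 (ends g) = ends (mar phi g).
Proof. by rewrite /ends /mob2 mar_src mar_tgt. Qed.

Definition hypercover_square (g : ar G) : fib_space mob2 (@ends H) :=
  exist _ (ends g, mar phi g) (hypercover_compat g).

Definition hypercover : Prop :=
  surjective_submersion (mob phi) /\ diffeomorphism hypercover_square.

End NerveMap.

(* Vector space structures on the fibres of [p]: the fibre over [b] is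
   identified by [inc b] with the vector space [fib b]. *)
Record linear_fibres (R : realType) (E B : smooth_space R) (p : E -> B) :=
    LinearFibres {
  fib : B -> lmodType R;
  inc : forall b, fib b -> E;
  inc_over : forall b (v : fib b), p (inc v) = b;
  inc_inj : forall b, injective (@inc b);
  inc_surj : forall e, exists v : fib (p e), inc v = e
}.

Arguments inc {R E B p} l b v.

Definition locally_trivial (R : realType) (E B : smooth_space R) (p : E -> B)
    (L : linear_fibres p) : Prop :=
  forall b0 : B, exists (U : set B) (r : nat) (Phi : E -> 'rV[R]_r)
      (Psi : prod_space B (euclidean R r) -> E),
    [/\ open U, U b0,
        diffeo_on (N := prod_space B (euclidean R r))
          (p @^-1` U) [set x | U x.1] (fun e => (p e, Phi e)) Psi &
        forall b, U b -> linear (fun v => Phi (inc L b v))].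

Record higher_vector_bundle (R : realType) (B : simplicial_space R) :=
    HigherVectorBundle {
  total : simplicial_space R;
  total_manifold : simplicial_manifold total;
  proj : simplicial_map total B;
  fibres : forall n, linear_fibres (@smap R total B proj n);
  fibres_trivial : forall n, locally_trivial (fibres n);
  act_linear : forall m n (a : Delta m n) (b : B n),
    exists L : {linear fib (fibres n) b -> fib (fibres m) (act a b)},
      forall v, act a (inc (fibres n) b v) = inc (fibres m) (act a b) (L v);
  proj_fibration : fibration proj
}.

Section Pullback.
Variables (R : realType) (X Y V : simplicial_space R).
Variables (f : simplicial_map X Y) (p : simplicial_map V Y).

Definition pull_space n : smooth_space R :=
  fib_space (@smap _ _ _ f n) (@smap _ _ _ p n).

Lemma pull_compat m n (a : Delta m n) (x : pull_space n) :
  f m (act a (sval x).1) = p m (act a (sval x).2).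
Proof. by rewrite !smap_act (svalP x). Qed.

Definition pull_act m n (a : Delta m n) (x : pull_space n) : pull_space m :=
  exist _ (act a (sval x).1, act a (sval x).2) (pull_compat a x).

Lemma pull_act_smooth m n (a : Delta m n) : smooth_map (pull_act a).
Proof.
pose b (i : bool) : two_spaces (X n) (V n) i -> two_spaces (X m) (V m) i :=
  match i with true => act a | false => act a end.
apply: (@initial_smooth_map _ _ _ _ _ _ _ _ _ id b).
  by move=> []; exact: act_smooth.
by case=> t; reflexivity.
Qed.

Lemma pull_act_id n (x : pull_space n) : pull_act (oid n) x = x.
Proof. by apply: sval_inj; case: x => [[x v] e] /=; rewrite !act_id. Qed.

Lemma pull_act_comp l m n (a : Delta m n) (b : Delta l m) (x : pull_space n) :
  pull_act (ocomp a b) x = pull_act b (pull_act a x).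
Proof. by apply: sval_inj; rewrite /= !act_comp. Qed.

Definition pullback : simplicial_space R :=
  SimplicialSpace pull_act_smooth pull_act_id pull_act_comp.

Definition pull_proj n (x : pullback n) : X n := (sval x).1.
Definition pull_canon n (x : pullback n) : V n := (sval x).2.

Section PullFibres.
Variables (n : nat) (L : linear_fibres (@smap _ _ _ p n)).

Definition pull_inc (x : X n) (v : fib L (f n x)) : pullback n :=
  exist _ (x, inc L (f n x) v) (esym (inc_over v)).

Lemma pull_inc_inj x : injective (@pull_inc x).
Proof. by move=> v w [/inc_inj]. Qed.

Lemma pull_inc_surj (e : pullback n) : exists v, @pull_inc (pull_proj e) v = e.
Proof.
case: e => [[x e] /= fe]; have [v ve] := inc_surj L e.
rewrite /pull_proj /=; move: v ve; rewrite -fe => v ve.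
by exists v; apply: sval_inj => /=; rewrite ve.
Qed.

Definition pull_fibres : linear_fibres (@pull_proj n) :=
  LinearFibres (fun x v => erefl) pull_inc_inj pull_inc_surj.

End PullFibres.
End Pullback.

(* A complex of subspaces: the cochains of degree [n] are the elements of
   [ambient n] in [cochain n]. *)
Record cochains (R : realType) := Cochains {
  ambient : nat -> lmodType R;
  cochain : forall n, set (ambient n);
  diff_cochain : forall n, ambient n -> ambient n.+1
}.

Section Cohomology.
Variables (R : realType) (C D : cochains R).

Definition cocycle (A : cochains R) n (c : ambient A n) : Prop :=
  cochain c /\ diff_cochain c = 0.

Definition coboundary (A : cochains R) n : ambient A n -> Prop :=
  match n with
  | 0 => fun c => c = 0
  | m.+1 => fun c => exists2 b : ambient A m, cochain b & diff_cochain b = c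
  end.

Definition cochain_map (f : forall n, ambient C n -> ambient D n) : Prop :=
  forall n, [/\ linear (@f n), forall c, cochain c -> cochain (f n c) &
    forall c, cochain c -> f n.+1 (diff_cochain c) = diff_cochain (f n c)].

(* The map induced on H^n = cocycles / coboundaries is injective and
   surjective for all [n]. *)
Definition quasi_isomorphism (f : forall n, ambient C n -> ambient D n) : Prop :=
  cochain_map f /\
  forall n,
    (forall c c' : ambient C n, cocycle c -> cocycle c' ->
       coboundary (f n c - f n c') -> coboundary (c - c')) /\
    (forall d : ambient D n, cocycle d ->
       exists2 c : ambient C n, cocycle c & coboundary (d - f n c)).

End Cohomology.

Section LinearCochains.
Variables (R : realType) (V : simplicial_space R) (B : nat -> smooth_space R).
Variables (p : forall n, V n -> B n) (L : forall n, linear_fibres (@p n)).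

Definition linear_cochain n : set (V n -> R) :=
  [set c | smooth_function c /\ forall b, scalar (fun v => c (inc (L n) b v))].

(* The differential up to a sign depending only on the degree, which does not
   affect cocycles and coboundaries. *)
Definition linear_diff n (c : V n -> R) : V n.+1 -> R :=
  fun x => \sum_(i < n.+2) (-1) ^+ i * c (act (coface i) x).

Definition linear_cochains : cochains R :=
  Cochains (ambient := fun n => V n -> R) linear_cochain linear_diff.

End LinearCochains.

Section HigherVectorBundleCochains.
Variables (R : realType) (G H : lie_groupoid R) (phi : lie_morphism G H).
Variable V : higher_vector_bundle (nerve H).

Definition C_lin : cochains R := linear_cochains (fibres V).

Definition C_lin_pullback : cochains R :=
  linear_cochains (V := pullback (nerve_map phi) (proj V))
    (fun n => pull_fibres (nerve_map phi) (fibres V n)).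

Definition pull_cochain n (c : ambient C_lin n) : ambient C_lin_pullback n :=
  fun x => c (pull_canon x).

End HigherVectorBundleCochains.

(* Main.v *)
From HB Require Import structures.
Require Import Defs.
From mathcomp Require Import all_boot all_order all_algebra.
From mathcomp Require Import all_classical all_reals all_analysis.
From mathcomp Require Import ring lra zify.

(** Points of [G_0] cannot be averaged, so the partition of unity acts on the real values of
    cochains and never on the sections themselves. With one common index, weighted at a chosen
    vertex, the face dropping that vertex would not be respected; independent indices treat all
    faces alike. A local section may be continued arbitrarily outside its domain: a term of the
    average that uses it at a bad vertex carries a weight that vanishes nearby. The pullback never
    needs charts: smoothness is checked on germs, and the germs of an initial structure are closed
    under smooth operations, which is all that sums and products of cochains require. The analytic
    input is an inverse function theorem, which yields sections of submersions, and the flat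
    function [exp(-1/t)], which yields bumps. *)

(* A hypercover identifies G_n with the pairs of an n-simplex of H and lifts
   x_0, ..., x_n to G_0 of its vertices, so the n-simplices of the pullback of V
   are pairs (x; v) of a simplex v of V and lifts x of its vertices. If phi_0 had
   a smooth section s, then v |-> (s(y); v), with y the vertices of v, would be a
   simplicial map, inverse to the projection up to the simplicial homotopy
   (x_0, ..., x_i, s(y_i), ..., s(y_n); s_i v). In general there are only local
   sections s_k and a partition of unity rho_k on H_0. Choose s_{a_i} at the vertex
   y_i with a_0, a_1, ... independent and a_i = k with probability rho_k(y_i), and
   take expectations of linear functions: since the weights sum to 1, dropping a
   vertex drops its index, so the averages are compatible with the faces, and the
   same homotopy formula shows that averaging is inverse to phi^* in cohomology.
   Degeneracies of V are linear, so all of this preserves linear cochains. *)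

Set Implicit Arguments.
Unset Strict Implicit.
Unset Printing Implicit Defensive.

Import Order.TTheory GRing.Theory Num.Theory numFieldNormedType.Exports.

Local Open Scope classical_set_scope.
Local Open Scope ring_scope.

(** * Smooth functions on R^n *)

Section SmoothCalculus.
Variable R : realType.

Lemma CkS n k (U : set 'rV[R]_n) f : Ck k.+1 U f -> Ck k U f.
Proof.
elim: k f => [|k IH] f [df Df] /=.
  by move=> x Ux; exact/differentiable_continuous/df.
by split=> // v; exact: IH.
Qed.

Lemma Ck_cst n k (U : set 'rV[R]_n) (c : R) : Ck k U (fun=> c).
Proof.
elim: k c => [|k IH] c /=; first by move=> x _; exact: cst_continuous.
split=> [x _|v]; first exact: differentiable_cst.
by under eq_fun do rewrite derive_cst; exact: IH.
Qed.

Lemma derive_linear (V W : normedModType R) (f : {linear V -> W}) x v :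
  continuous f -> 'D_v f x = f v.
Proof.
by move=> cf; rewrite deriveE ?diff_lin//; exact: linear_differentiable.
Qed.

Lemma derive_coord n (j : 'I_n) (x v : 'rV[R]_n) :
  'D_v (fun y : 'rV[R]_n => y 0 j : R) x = v 0 j.
Proof.
have := derive_id x v; rewrite derive_mx; last exact: derivable_id.
by move=> /rowP/(_ j); rewrite mxE.
Qed.

Lemma Ck_coord n k (U : set 'rV[R]_n) (j : 'I_n) :
  Ck k U (fun y : 'rV[R]_n => y 0 j : R).
Proof.
case: k => [|k] /=; first by move=> x _; exact: coord_continuous.
split=> [x _|v]; first exact: differentiable_coord.
under eq_fun do rewrite derive_coord.
exact: Ck_cst.
Qed.

Lemma CkD n k (U : set 'rV[R]_n) f g : open U ->
  Ck k U f -> Ck k U g -> Ck k U (fun x => f x + g x).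
Proof.
move=> oU; elim: k f g => [|k IH] f g /=.
  by move=> cf cg x Ux; apply: continuousD; [exact: cf|exact: cg].
move=> [df Df] [dg Dg]; split=> [x Ux|v].
  by apply: differentiableD; [exact: df|exact: dg].
apply: (Ck_ext oU _ _ (IH _ _ (Df v) (Dg v))) => // x Ux.
by rewrite -deriveD //; apply: diff_derivable; [exact: df|exact: dg].
Qed.

Lemma CkM n k (U : set 'rV[R]_n) f g : open U ->
  Ck k U f -> Ck k U g -> Ck k U (fun x => f x * g x).
Proof.
move=> oU; elim: k f g => [|k IH] f g.
  by move=> cf cg x Ux; apply: continuousM; [exact: cf|exact: cg].
move=> Cf Cg; have [Cf' Cg'] := (CkS Cf, CkS Cg).
case: Cf Cg => [df Df] [dg Dg]; split=> [x Ux|v].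
  by apply: differentiableM; [exact: df|exact: dg].
apply: (Ck_ext oU _ _ (CkD oU (IH _ _ Cf' (Dg v)) (IH _ _ Cg' (Df v)))) => //.
move=> x Ux.
by symmetry; apply: deriveM; apply: diff_derivable; [exact: df|exact: dg].
Qed.

Lemma Ck_sum n k (U : set 'rV[R]_n) (I : Type) (r : seq I) (P : pred I)
    (f : I -> 'rV[R]_n -> R) :
  open U -> (forall i, Ck k U (f i)) -> Ck k U (fun x => \sum_(i <- r | P i) f i x).
Proof.
move=> oU Cf; elim: r => [|i r IH].
  by under eq_fun do rewrite big_nil; exact: Ck_cst.
under eq_fun do rewrite big_cons; case: (P i) => //; exact: (CkD oU (Cf i) IH).
Qed.

Lemma differentiable_row (V : normedModType R) n (g : 'I_n -> V -> R) (x : V) :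
  (forall j, differentiable (g j) x) ->
  differentiable (fun y => \row_j g j y) x.
Proof.
move=> dg.
have -> : (fun y => \row_j g j y) =
    \sum_(j < n) (fun y => g j y *: (delta_mx 0 j : 'rV[R]_n)).
  apply/funext => y; rewrite fct_sumE [LHS]row_sum_delta.
  by apply: eq_bigr => j _; rewrite mxE.
by apply: differentiable_sum => j; exact: differentiableZl.
Qed.

Lemma differentiable_coordP (V : normedModType R) n (f : V -> 'rV[R]_n) (x : V) :
  (forall j, differentiable (fun y => f y 0 j : R) x) -> differentiable f x.
Proof.
move=> df; have -> : f = fun y => \row_j f y 0 j; last exact: differentiable_row.
by apply/funext => y; apply/rowP => j; rewrite mxE.
Qed.

Lemma continuous_row (T : topologicalType) n (g : 'I_n -> T -> R) (x : T) :
  (forall j, {for x, continuous (g j)}) ->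
  {for x, continuous (fun y => \row_j g j y)}.
Proof.
move=> cg A [P tP PA].
have FF : Filter (nbhs x) by exact: nbhs_filter.
have H a j : \forall s \near x, P a j (g j s).
  by apply: (cg j); have := tP a j; rewrite mxE.
have := filter_forall FF (fun a => filter_forall FF (H a)).
by apply: filterS => s Hs; apply: PA => a j; rewrite /= mxE.
Qed.

Lemma derive_coordE (V : normedModType R) n (f : V -> 'rV[R]_n) (x v : V) j :
  differentiable f x -> 'D_v (fun y => f y 0 j : R) x = ('D_v f x) 0 j.
Proof. by move=> df; rewrite derive_mx ?mxE//; exact: diff_derivable. Qed.

Lemma derive_rowE n (F : 'rV[R]_n -> R) (x w : 'rV[R]_n) :
  differentiable F x -> 'D_w F x = \sum_j w 0 j * 'D_(delta_mx 0 j) F x.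
Proof.
move=> dF; rewrite deriveE// [w in LHS]row_sum_delta linear_sum.
by apply: eq_bigr => j _; rewrite linearZ -deriveE.
Qed.

(** By the chain rule the derivative is a sum of products of some ['D_v (g j)] with a partial
    derivative of [F] along the row. The induction on [k] therefore has to vary [F]. *)
Lemma Ck_comp n l k (U : set 'rV[R]_n) (V : set 'rV[R]_l) F
    (g : 'I_l -> 'rV[R]_n -> R) :
  open U -> (forall x, U x -> V (\row_j g j x)) ->
  Ck k V F -> (forall j, Ck k U (g j)) -> Ck k U (fun x => F (\row_j g j x)).
Proof.
move=> oU UV; elim: k F => [|k IH] F.
  move=> cF cg x Ux.
  apply: (continuous_comp (f := fun x => \row_j g j x)); last exact/cF/UV.
  by apply: continuous_row => j; exact: cg.
move=> [dF DF] Cg; split=> [x Ux|v].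
  apply: (differentiable_comp (f := fun x => \row_j g j x)); last exact/dF/UV.
  by apply: differentiable_row => j; apply: (Cg j).1.
pose D x := \sum_j 'D_v (g j) x * 'D_(delta_mx 0 j) F (\row_j g j x).
apply: (@Ck_ext _ _ _ U U D) => //; last first.
  apply: Ck_sum => // j; apply: CkM => //; first exact: (Cg j).2.
  by apply: (IH _ (DF _)) => j'; exact: CkS.
move=> x Ux; have dg : differentiable (fun x => \row_j g j x) x.
  by apply: differentiable_row => j; apply: (Cg j).1.
have dFx : differentiable F (\row_j g j x) by exact/dF/UV.
rewrite deriveE; last exact: (differentiable_comp (f := fun x => \row_j g j x)).
rewrite (diff_comp (f := fun x => \row_j g j x))//= -(deriveE v dg) -(deriveE _ dFx).
rewrite derive_rowE //; apply: eq_bigr => j _; rewrite derive_mx ?mxE//.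
  by congr (_ * _); congr ('D_v _ x); apply/funext => y; rewrite mxE.
exact: diff_derivable.
Qed.

Lemma CkV n k (U : set 'rV[R]_n) f : open U -> (forall x, U x -> f x != 0) ->
  Ck k U f -> Ck k U (fun x => (f x)^-1).
Proof.
move=> oU f0; elim: k => [|k IH] Cf.
  by move=> x Ux; apply: continuousV; [exact: f0|exact: Cf].
have Cf' := IH (CkS Cf); case: Cf => df Df; split=> [x Ux|v].
  by apply: differentiableV; [exact: df|exact: f0].
apply: (@Ck_ext _ _ _ U U (fun x => -1 * ((f x)^-1 * (f x)^-1 * 'D_v f x))) => //.
  move=> x Ux; rewrite deriveV; [|exact: f0|exact/diff_derivable/df].
  by rewrite mulN1r scaleNr expr2 invfM.
exact: (CkM oU (Ck_cst k U (-1)) (CkM oU (CkM oU Cf' Cf') (Df v))).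
Qed.

Lemma Ck_prod n k (U : set 'rV[R]_n) (I : Type) (r : seq I) (P : pred I)
    (f : I -> 'rV[R]_n -> R) :
  open U -> (forall i, Ck k U (f i)) ->
  Ck k U (fun x => \prod_(i <- r | P i) f i x).
Proof.
move=> oU Cf; elim: r => [|i r IH].
  by under eq_fun do rewrite big_nil; exact: Ck_cst.
under eq_fun do rewrite big_cons; case: (P i) => //; exact: (CkM oU (Cf i) IH).
Qed.

Lemma Ck_det n l k (U : set 'rV[R]_n) (A : 'rV[R]_n -> 'M[R]_l) : open U ->
  (forall i j, Ck k U (fun x => A x i j)) -> Ck k U (fun x => \det (A x)).
Proof.
move=> oU CA; apply: Ck_sum => // s; apply: CkM => //; first exact: Ck_cst.
exact: Ck_prod.
Qed.

Lemma Ck_adj n l k (U : set 'rV[R]_n) (A : 'rV[R]_n -> 'M[R]_l) i j : open U ->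
  (forall i j, Ck k U (fun x => A x i j)) -> Ck k U (fun x => (\adj (A x)) i j).
Proof.
move=> oU CA; under eq_fun do rewrite mxE.
apply: CkM => //; first exact: Ck_cst.
by apply: Ck_det => // a b; under eq_fun do rewrite !mxE; exact: CA.
Qed.

(** Cramer's rule makes the entries polynomials in those of [A x], divided by the determinant. *)
Lemma Ck_invmx n l k (U : set 'rV[R]_n) (A : 'rV[R]_n -> 'M[R]_l) i j : open U ->
  (forall x, U x -> A x \in unitmx) ->
  (forall i j, Ck k U (fun x => A x i j)) -> Ck k U (fun x => invmx (A x) i j).
Proof.
move=> oU uA CA.
apply: (@Ck_ext _ _ _ U U (fun x => (\det (A x))^-1 * (\adj (A x)) i j)) => //.
  by move=> x Ux; rewrite /invmx uA //= [RHS]mxE.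
apply: CkM => //; last exact: Ck_adj.
apply: CkV => //; last exact: Ck_det.
by move=> x /uA; rewrite unitmxE unitfE.
Qed.

Lemma Ck_sub n k (U V : set 'rV[R]_n) f :
  open V -> V `<=` U -> Ck k U f -> Ck k V f.
Proof. by move=> oV VU; exact: Ck_ext. Qed.

End SmoothCalculus.

(** * The inverse function theorem *)

Section InverseFunction.
Variable R : realType.

Lemma row_coord_le n (x : 'rV[R]_n) j : `|x 0 j| <= `|x|.
Proof.
rewrite [leRHS]/Num.Def.normr/= mx_normrE.
exact: (le_bigmax _ (fun ij => `|x ij.1 ij.2|) (ord0, j)).
Qed.

Lemma row_norm_le n (x : 'rV[R]_n) e :
  0 <= e -> (forall j, `|x 0 j| <= e) -> `|x| <= e.
Proof.
move=> e0 xe; rewrite /Num.Def.normr/= mx_normrE.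
by apply: bigmax_le => // -[i j] _ /=; rewrite ord1.
Qed.

Lemma compact_cball n (a : 'rV[R]_n) d : compact [set y | `|y - a| <= d].
Proof.
apply: bounded_closed_compact.
  exists (`|a| + d); split; first exact: num_real.
  move=> M aM y /= yd; rewrite (le_trans _ (ltW aM))// -[y](subrK a).
  by rewrite (le_trans (ler_normD _ _))// addrC lerD2l.
apply: (@closed_comp _ _ (fun y : 'rV[R]_n => `|y - a|) [set t | t <= d]).
  move=> y _.
  apply: (@continuous_comp _ _ _ (fun z : 'rV[R]_n => z - a) (fun z => `|z|)).
    by apply: continuousB; [exact: cvg_id|exact: cst_continuous].
  exact: norm_continuous.
exact: closed_le.
Qed.

(** The one-variable mean value theorem along the segment from [y] to [x] gives a different
    intermediate point for each coordinate; this is harmless because the norm is the maximum of the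
    coordinates. *)
Lemma mean_value_ineq n m (f : 'rV[R]_n -> 'rV[R]_m) (a : 'rV[R]_n) (d q : R) :
  0 <= q ->
  (forall y : 'rV[R]_n, `|y - a| <= d -> differentiable f y) ->
  (forall y v : 'rV[R]_n, `|y - a| <= d -> `|'D_v f y| <= q * `|v|) ->
  forall x y : 'rV[R]_n, `|x - a| <= d -> `|y - a| <= d -> `|f x - f y| <= q * `|x - y|.
Proof.
move=> q0 df Df x y xd yd.
pose l (t : R) := t *: (x - y) + y.
have ld (t : R) : 0 <= t <= 1 -> `|l t - a| <= d.
  move=> /andP[t0 t1].
  have -> : l t - a = t *: (x - a) + (1 - t) *: (y - a).
    by apply/rowP => j; rewrite /l !mxE; ring.
  rewrite (le_trans (ler_normD _ _))// !normrZ !ger0_norm ?subr_ge0//.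
  rewrite [leRHS](_ : _ = t * d + (1 - t) * d); last by ring.
  by rewrite lerD// ler_wpM2l// subr_ge0.
have dl t : differentiable l t.
  by apply: differentiableD => //; apply: differentiableZl.
apply: row_norm_le => [|j]; first by rewrite mulr_ge0.
pose h (t : R) : R := f (l t) 0 j.
have dh (t : R) : 0 <= t <= 1 -> is_derive t 1 h (('D_(x - y) f (l t)) 0 j).
  move=> t01; have dfl := df _ (ld _ t01).
  have dfj : differentiable (fun z => f z 0 j : R) (l t).
    apply: (differentiable_comp (g := fun z : 'rV_m => z 0 j : R)) => //.
    exact: differentiable_coord.
  have dh : differentiable h t.
    exact: (differentiable_comp (f := l) (g := fun z => f z 0 j : R)).
  apply: DeriveDef; first exact: diff_derivable.
  rewrite deriveE// (diff_comp (f := l) (g := fun z => f z 0 j : R))//=.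
  rewrite -derive_coordE // deriveE//; congr ('d _ _ _).
  rewrite -deriveE // deriveD; first last.
  - by apply: diff_derivable.
  - by apply: diff_derivable; exact: differentiableZl.
  rewrite derive_cst addr0 deriveE; last exact: differentiableZl.
  by rewrite diff_val scale1r.
have [|||c c01] := @MVT_segment R h (fun t => ('D_(x - y) f (l t)) 0 j) 0 1.
- exact: ler01.
- by move=> t; rewrite in_itv /= => /andP[t0 t1]; apply: dh; rewrite !ltW.
- apply: derivable_within_continuous => t; rewrite in_itv /= => t01.
  by case: (dh t t01).
rewrite /h /l scale1r scale0r subrK add0r subr0 mulr1 !mxE => ->.
apply: le_trans (row_coord_le _ _) _; apply: Df; apply: ld.
by move: c01; rewrite in_itv.
Qed.

(* [x |-> g x - x] is 1/2-Lipschitz on the ball that this provides. *)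
Lemma derivative_near_id n (U : set 'rV[R]_n) (g : 'rV[R]_n -> 'rV[R]_n) a :
  open U -> U a -> (forall j, Ck 1 U (fun y => g y 0 j)) ->
  (forall v, 'D_v g a = v) ->
  exists2 d : R, 0 < d & forall y, `|y - a| <= d ->
    U y /\ forall v, `|'D_v g y - v| <= 2^-1 * `|v|.
Proof.
move=> oU Ua Cg ga; have dg y : U y -> differentiable g y.
  by move=> Uy; apply: differentiable_coordP => j; exact: (Cg j).1.
(* Each coordinate of the error is a sum of [n] terms of size at most [e * |v|]; [n.+1] keeps [e]
   positive when [n = 0]. *)
pose e : R := (n.+1%:R * 2)^-1.
have e0 : 0 < e by rewrite invr_gt0 mulr_gt0.
have near_e i j : \forall y \near a,
    `|'D_(delta_mx 0 i) (fun y => g y 0 j : R) y - (i == j)%:R| <= e.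
  have := (Cg j).2 (delta_mx 0 i) a Ua.
  rewrite /prop_for /continuous_at => /cvgrPdist_le/(_ e e0).
  rewrite derive_coordE ?ga; last exact: dg.
  by rewrite mxE eqxx /= eq_sym; apply: filterS => y; rewrite distrC.
have FF : Filter (nbhs a) by exact: nbhs_filter.
have near_all := filter_forall FF (fun i => filter_forall FF (near_e i)).
have near_U : \forall y \near a, U y by exact: open_nbhs_nbhs.
have [d dP] := (nbhs_closedballP _ _).1 (filterI near_U near_all).
exists d%:num => // y yd.
have /dP[Uy ye] : closed_ball a d%:num y.
  by rewrite closed_ballE// /closed_ball_ /= distrC.
split=> // v; apply: row_norm_le => [|j]; first by rewrite mulr_ge0.
rewrite mxE -derive_coordE; last exact: dg.
rewrite derive_rowE; last exact: (Cg j).1.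
have -> : (- v) 0 j = - \sum_i v 0 i * (i == j)%:R.
  rewrite mxE (bigD1 j)//= eqxx mulr1 big1 ?addr0// => i /negPf->.
  by rewrite mulr0.
rewrite -sumrB (le_trans (ler_norm_sum _ _ _))//.
apply: (@le_trans _ _ (\sum_(i < n) `|v| * e)).
  apply: ler_sum => i _; rewrite -mulrBr normrM ler_pM//; exact: row_coord_le.
rewrite sumr_const card_ord -[_ *+ _]mulr_natr mulrAC -mulrA mulrC ler_wpM2r//.
rewrite /e invfM mulrA ler_piMl// ler_pdivrMr// mul1r ler_nat.
exact: leqnSn.
Qed.

(* A minimum of [`|T y - y|] over the compact ball is a fixed point of the
   contraction [T y = y + z - g y]. *)
Lemma near_id_surjective n (g : 'rV[R]_n -> 'rV[R]_n) a (d : R) z : 0 <= d ->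
  (forall y, `|y - a| <= d -> {for y, continuous g}) ->
  (forall x y, `|x - a| <= d -> `|y - a| <= d ->
    `|(g x - x) - (g y - y)| <= 2^-1 * `|x - y|) ->
  `|z - g a| <= 2^-1 * d -> exists2 y, `|y - a| <= d & g y = z.
Proof.
move=> d0 cg lip zd.
have aa : `|a - a| <= d by rewrite subrr normr0.
pose T y := y + z - g y.
have TT y : `|y - a| <= d -> `|T y - a| <= d.
  move=> yd; have -> : T y - a = (z - g a) - ((g y - y) - (g a - a)).
    by apply/rowP => j; rewrite !mxE; ring.
  apply: le_trans (ler_normB _ _) _; have := lip _ _ yd aa; lra.
have cT : {within [set y | `|y - a| <= d], continuous (fun y => `|T y - y|)}.
  apply: continuous_in_subspaceT => y; rewrite inE /= => yd.
  apply: (@continuous_comp _ _ _ (fun y => T y - y) (fun z => `|z|)).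
    apply: continuousB; last exact: cvg_id.
    apply: continuousB; last exact: cg.
    by apply: continuousD; [exact: cvg_id|exact: cst_continuous].
  exact: norm_continuous.
have [|y yd ymin] := EVT_min_rV _ (compact_cball (a := a) (d := d)) cT.
  by exists a.
rewrite inE /= in yd; exists y => //; apply/eqP.
have := ymin (T y); rewrite inE /= => /(_ (TT _ yd)).
have -> : T (T y) - T y = - ((g (T y) - T y) - (g y - y)).
  by apply/rowP => j; rewrite !mxE; ring.
rewrite normrN => /le_trans/(_ (lip _ _ (TT _ yd) yd)) h.
have : `|T y - y| <= 0 by have := normr_ge0 (T y - y); lra.
rewrite normr_le0 subr_eq0 /T => /eqP/rowP E.
by apply/eqP/rowP => j; have := E j; rewrite !mxE; lra.
Qed.

Lemma unitmx_inj n (A : 'M[R]_n) :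
  (forall v : 'rV_n, v *m A = 0 -> v = 0) -> A \in unitmx.
Proof.
move=> inj; rewrite -row_free_unit -kermx_eq0; apply/eqP/row_matrixP => i.
by rewrite row0; apply: inj; rewrite -row_mul mulmx_ker row0.
Qed.

Lemma mulmxr_continuous n m (A : 'M[R]_(n, m)) :
  continuous (fun v : 'rV[R]_n => v *m A).
Proof.
move=> x.
have -> : (fun v : 'rV[R]_n => v *m A) =
          fun v => \row_j \sum_i v 0 i * A i j.
  by apply/funext => v; apply/rowP => j; rewrite !mxE.
apply: continuous_row => j.
apply: (Ck_sum (k := 0) _ _ openT) => // i.
by apply: CkM; [exact: openT|exact: Ck_coord|exact: Ck_cst].
Qed.

(** Applying [B] to the first order expansion of [g] at [t z] gives that of [t]; the Lipschitz bound
    on [t] turns an error small against [t w - t z] into one small against [w - z]. *)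
Lemma inverse_differentiable (V W : normedModType R) (g : V -> W) (t : W -> V)
    z (B : {linear W -> V}) :
  continuous B -> differentiable g (t z) -> (forall v, B ('D_v g (t z)) = v) ->
  (\forall w \near z, g (t w) = w) ->
  (\forall w \near z, `|t w - t z| <= 2 * `|w - z|) ->
  differentiable t z /\ forall v, 'D_v t z = B v.
Proof.
move=> cB dg gB gt lip; have [c c0 Bc] := linear_lipschitz cB.
have gtz : g (t z) = z := nbhs_singleton gt.
have ct : {for z, continuous t}.
  have FF : Filter (nbhs z) by exact: nbhs_filter.
  apply/(@cvgrPdist_le _ _ _ _ FF t (t z)) => e e0.
  have : \forall w \near z, `|z - w| <= 2^-1 * e.
    by apply: ((@cvgrPdist_le _ _ _ _ FF id z).1 (@cvg_id _ _)); rewrite mulr_gt0.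
  apply: (@filterS2 _ _ (nbhs_filter z)) lip => w.
  by rewrite distrC (distrC w z) => h1 h2; lra.
have Et : t \o shift z = cst (t z) + B +o_ 0 id.
  apply/eqaddoP => e e0; have /diff_locallyP := dg => -[_ /eqaddoP].
  (* [c] bounds [B] and 2 is the Lipschitz constant of [t]; both cancel in the final estimate. *)
  have e'0 : 0 < e / (2 * c) by rewrite divr_gt0// mulr_gt0.
  move=> /(_ _ e'0) ge.
  have gz : \forall w \near z, `|g (t w) - g (t z) - 'd g (t z) (t w - t z)| <=
                               e / (2 * c) * `|t w - t z|.
    apply: (ct [set y | `|g y - g (t z) - 'd g (t z) (y - t z)| <=
                        e / (2 * c) * `|y - t z|]).
    apply/nbhs0P; apply: filterS ge => h /=.
    by rewrite !fctE /= opprD addrA [h + _]addrC [_ + h - _]addrAC subrr add0r.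
  have : \forall w \near z,
      `|t w - t z - B (w - z)| <= e * `|w - z|.
    apply: (@filterS3 _ _ (nbhs_filter z)) gz gt lip => w gw gtw lipw.
    have -> : t w - t z - B (w - z) =
              - B (g (t w) - g (t z) - 'd g (t z) (t w - t z)).
      by rewrite -(deriveE _ dg) [in RHS]linearB gB gtw gtz opprB.
    rewrite normrN (le_trans (Bc _))// -ler_pdivlMl// (le_trans gw)//.
    rewrite (le_trans (ler_wpM2l (ltW e'0) lipw))//.
    rewrite le_eqVlt; apply/orP; left; apply/eqP; field.
    by rewrite gt_eqF.
  move=> /nbhs0P; apply: filterS => h /=.
  by rewrite !fctE /= opprD addrA [h + _]addrC [_ + h - _]addrAC subrr add0r.
have dB := diff_unique cB Et.
have dt : differentiable t z by apply/diff_locallyP; rewrite dB.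
by split=> // v; rewrite deriveE// dB.
Qed.

End InverseFunction.

(** * Smooth inverses, and local sections of submersions between Euclidean spaces *)

Section LocalSection.
Variable R : realType.

(** Normalising the derivative at [a] to the identity makes [g] a small Lipschitz perturbation of
    the identity on a ball. The application to submersions is arranged to have this form. *)
Lemma smooth_inverse n (U : set 'rV[R]_n) (g : 'rV[R]_n -> 'rV[R]_n) a :
  open U -> U a -> (forall k j, Ck k U (fun y => g y 0 j)) ->
  (forall v, 'D_v g a = v) ->
  exists (W : set 'rV[R]_n) (t : 'rV[R]_n -> 'rV[R]_n),
    [/\ open W, W (g a), t (g a) = a, forall z, W z -> U (t z) /\ g (t z) = z &
        forall k i, Ck k W (fun z => t z 0 i)].
Proof.
move=> oU Ua Cg ga.
have [d d0 Ud] := derivative_near_id oU Ua (Cg 1%N) ga.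
have dg y : U y -> differentiable g y.
  by move=> Uy; apply: differentiable_coordP => j; exact: (Cg 1%N j).1.
have cg y : U y -> {for y, continuous g} by move/dg/differentiable_continuous.
pose D y := \matrix_(i, j) 'D_(delta_mx 0 i) (fun y => g y 0 j : R) y.
have gD y v : U y -> 'D_v g y = v *m D y.
  move=> Uy; apply/rowP => j; rewrite mxE -derive_coordE; last exact: dg.
  rewrite derive_rowE; last exact: (Cg 1%N j).1.
  by apply: eq_bigr => i _; rewrite mxE.
(* A vector [v] killed by the Jacobian would satisfy [|v| <= |v| / 2]. *)
have uD y : `|y - a| <= d -> D y \in unitmx.
  move=> /Ud[Uy yd]; apply: unitmx_inj => v v0; apply/eqP.
  have := yd v; rewrite gD// v0 sub0r normrN -normr_le0.
  by have := normr_ge0 v; lra.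
have lip x y : `|x - a| <= d -> `|y - a| <= d ->
    `|(g x - x) - (g y - y)| <= 2^-1 * `|x - y|.
  apply: (@mean_value_ineq _ _ _ (fun y => g y - y) a d) => //.
    by move=> z /Ud[Uz _]; apply: differentiableB => //; exact: dg.
  move=> z v /Ud[Uz zv]; rewrite deriveB ?derive_id//.
  exact/diff_derivable/dg.
(* This bound gives both the injectivity of [g] on the ball and the Lipschitz constant 2 of its
   inverse. *)
have expand x y : `|x - a| <= d -> `|y - a| <= d -> `|x - y| <= 2 * `|g x - g y|.
  move=> xd yd; have := lip _ _ xd yd.
  have -> : g x - x - (g y - y) = (g x - g y) - (x - y).
    by apply/rowP => j; rewrite !mxE; ring.
  have := ler_normB (g x - g y) (g x - g y - (x - y)).
  by rewrite subKr => h1 h2; lra.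
have aa : `|a - a| <= d by rewrite subrr normr0 ltW.
have /choice[t tP] z : exists y, `|z - g a| <= 2^-1 * d -> `|y - a| <= d /\ g y = z.
  have [zd|zd] := leP `|z - g a| (2^-1 * d); last by exists 0.
  have [|y yd yz] := near_id_surjective (ltW d0) _ lip zd; last by exists y.
  by move=> y /Ud[/cg].
pose W : set 'rV[R]_n := ball (g a) (2^-1 * d).
have oW : open W by exact: ball_open.
have Wle z : W z -> `|z - g a| <= 2^-1 * d.
  by rewrite /W -ball_normE /= distrC => /ltW.
have tW z : W z -> `|t z - a| <= d /\ g (t z) = z by move/Wle/tP.
have Wa : W (g a) by apply: ballxx; rewrite mulr_gt0.
have nW z : W z -> \forall w \near z, W w by move=> Wz; exact: open_nbhs_nbhs.
have dt z : W z -> differentiable t z /\ forall v, 'D_v t z = v *m invmx (D (t z)).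
  move=> Wz; have [tzd gtz] := tW z Wz; have [Utz _] := Ud _ tzd.
  pose B : {linear 'rV[R]_n -> 'rV[R]_n} := mulmxr (invmx (D (t z))).
  have FF : Filter (nbhs z) by exact: nbhs_filter.
  apply: (@inverse_differentiable R _ _ g t z B).
  - exact: mulmxr_continuous.
  - exact: dg.
  - by move=> v; rewrite gD//= -mulmxA mulmxV ?mulmx1//; exact: uD.
  - by apply: filterS (nW z Wz) => w /tW[].
  - apply: filterS (nW z Wz) => w /tW[twd gtw].
    by rewrite -[in leRHS]gtw -[in leRHS]gtz; exact: expand.
exists W, t; split => //.
- have [tad gta] := tW _ Wa; apply/eqP; rewrite -subr_eq0 -normr_le0.
  by have := expand _ _ tad aa; rewrite gta subrr normr0 mulr0.
- by move=> z /tW[/Ud[Uz _] gtz].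
(* The derivative of [t] is the inverse Jacobian of [g] at [t z], hence as often
   differentiable as [t]. *)
elim=> [|k IH] i /=.
  move=> z /dt[dtz _].
  apply: (@continuous_comp _ _ _ t (fun y : 'rV[R]_n => y 0 i : R)).
    exact: differentiable_continuous.
  exact: coord_continuous.
split=> [z /dt[dtz _]|v].
  apply: (differentiable_comp (f := t) (g := fun y : 'rV[R]_n => y 0 i : R)) => //.
  exact: differentiable_coord.
have rowt z : \row_j t z 0 j = t z by apply/rowP => j; rewrite mxE.
apply: (@Ck_ext _ _ _ W W
  (fun z => \sum_l v 0 l * invmx (D (\row_j t z 0 j)) l i)) => //.
  move=> z Wz; have [dtz Dtz] := dt z Wz; rewrite derive_coordE// Dtz mxE.
  by rewrite rowt.
apply: Ck_sum => // l; apply: CkM => //; first exact: Ck_cst.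
apply: Ck_invmx => //.
  by move=> z /tW[tzd _]; rewrite rowt; exact: uD.
move=> p q; apply: (@Ck_comp _ _ _ _ W U (fun y => D y p q)) => //.
  by move=> z /tW[/Ud[]]; rewrite rowt.
apply: (Ck_ext oU _ _ ((Cg k.+1 q).2 (delta_mx 0 p))) => // y _.
by rewrite mxE.
Qed.

Lemma smooth_near_common n m (x : 'rV[R]_n) (f : 'I_m -> 'rV[R]_n -> R) :
  (forall j, smooth_near x (f j)) ->
  exists U, [/\ open U, U x & forall k j, Ck k U (f j)].
Proof.
move=> /choice[U sU]; have FF : Filter (nbhs x) by exact: nbhs_filter.
have nU j : nbhs x (U j) by have [oU Ux _] := sU j; exact: open_nbhs_nbhs.
have nI : nbhs x [set y | forall j, U j y] by exact: (filter_forall FF nU).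
exists [set y | forall j, U j y]°; split; first exact: open_interior.
  exact: nI.
move=> k j; have [oU _ CU] := sU j; apply: Ck_sub (CU k).
  exact: open_interior.
by move=> y /interior_subset; apply.
Qed.

(** Choosing preimages of the basis vectors gives a linear right inverse [M] of the derivative. On
    the affine subspace through [x] that it parametrises by [l], the map [f] has the identity as
    derivative, hence a local inverse [t]; the section is [l \o t]. *)
Lemma submersion_local_section m n (f : 'rV[R]_m -> 'rV[R]_n) x :
  (forall j, smooth_near x (fun y => f y 0 j)) ->
  (forall w, exists v, 'd f x v = w) ->
  exists s : 'rV[R]_n -> 'rV[R]_m,
    [/\ s (f x) = x, forall i, smooth_near (f x) (fun z => s z 0 i) &
        \forall z \near f x, f (s z) = z].
Proof.
move=> /smooth_near_common[U [oU Ux Cf]] sf.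
have df : differentiable f x.
  by apply: differentiable_coordP => j; exact: (Cf 1%N j).1.
have /choice[v vP] (i : 'I_n) := sf (delta_mx 0 i).
pose M := \matrix_(i, j) v i 0 j.
have fM w : 'd f x (w *m M) = w.
  rewrite [w in LHS]row_sum_delta [w in RHS]row_sum_delta mulmx_suml.
  rewrite linear_sum; apply: eq_bigr => i _; rewrite -scalemxAl linearZ -rowE.
  by congr (_ *: _); rewrite -[RHS]vP; congr ('d f x _); apply/rowP => j; rewrite !mxE.
pose l (w : 'rV[R]_n) := x + w *m M.
have Cl k V j : open V -> Ck k V (fun w => l w 0 j).
  move=> oV; under eq_fun do rewrite /l !mxE.
  apply: CkD => //; first exact: Ck_cst.
  by apply: Ck_sum => // i; apply: CkM => //; [exact: Ck_coord|exact: Ck_cst].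
have rowl w : \row_j l w 0 j = l w by apply/rowP => j; rewrite mxE.
have dl w : differentiable l w.
  by apply: differentiable_coordP => j; apply: (Cl 1%N setT j openT).1.
have l0 : l 0 = x by rewrite /l mul0mx addr0.
have Dl w : 'D_w l 0 = w *m M.
  rewrite /l deriveD; first last.
  - apply: diff_derivable; rewrite (_ : (fun w => _) = fun w => l w - x).
      by apply: differentiableB.
    by apply/funext => y; rewrite /l addrC addKr.
  - by apply: diff_derivable.
  rewrite derive_cst add0r.
  pose B : {linear 'rV[R]_n -> 'rV[R]_m} := mulmxr M.
  by rewrite (@derive_linear _ _ _ B)//; exact: mulmxr_continuous.
have [||||W [t [oW Wa ta tW Ct]]] :=
    @smooth_inverse n (l @^-1` U) (f \o l) 0.
- by apply: open_comp => // w _; exact: differentiable_continuous.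
- by rewrite /= l0.
- move=> k j; under eq_fun do rewrite /= -rowl.
  apply: (@Ck_comp _ _ _ _ _ U (fun y => f y 0 j)) => //.
  + by apply: open_comp => // w _; exact: differentiable_continuous.
  + by move=> w; rewrite rowl.
  + move=> i; apply: Cl.
    by apply: open_comp => // w _; exact: differentiable_continuous.
- have dfl : differentiable f (l 0) by rewrite l0.
  move=> w; rewrite deriveE; last exact: differentiable_comp.
  have -> : 'd (f \o l) 0 w = 'd f (l 0) ('d l 0 w).
    by rewrite (diff_comp (dl 0) dfl).
  have -> : 'd l 0 w = w *m M by rewrite -Dl deriveE.
  by rewrite l0 fM.
move: Wa ta; rewrite /= l0 => Wa ta.
exists (l \o t); split => /=; first by rewrite ta.
  move=> i; exists W; split => // k.
  have rowt z : \row_j t z 0 j = t z by apply/rowP => j; rewrite mxE.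
  under eq_fun do rewrite -rowt.
  by apply: (@Ck_comp _ _ _ _ W setT (fun y => l y 0 i)) => //; exact/Cl/openT.
by apply: filterS (open_nbhs_nbhs (conj oW Wa)) => z /tW[].
Qed.

End LocalSection.

(** * Bump functions *)

Section Bump.
Variable R : realType.

(* [t^-m exp(-1/t)] for [t > 0]: a family closed under differentiation, up to
   linear combinations. *)
Definition flat m (t : R) : R :=
  if 0 < t then t^-1 ^+ m * expR (- t^-1) else 0.

Lemma flat_ge0 m t : 0 <= flat m t.
Proof.
rewrite /flat; case: ifP => // t0.
by rewrite mulr_ge0 ?expR_ge0// exprn_ge0// invr_ge0 ltW.
Qed.

Lemma flat_gt0 m t : 0 < t -> 0 < flat m t.
Proof. by move=> t0; rewrite /flat t0 mulr_gt0 ?expR_gt0// exprn_gt0// invr_gt0. Qed.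

Lemma flat_le0 m t : t <= 0 -> flat m t = 0.
Proof. by rewrite /flat leNgt => /negPf->. Qed.

(** The term of order [m.+1] of the exponential series at [t^-1] already beats [t^-1 ^+ m] by a
    factor [t^-1]. *)
Lemma flat_le m t : 0 < t -> flat m t <= m.+1`!%:R * t.
Proof.
move=> t0; rewrite /flat t0 expRN ler_pdivrMr ?expR_gt0//.
have /(expR_ge1Dxn m) h : 0 <= t^-1 by rewrite invr_ge0 ltW.
apply: (@le_trans _ _ (m.+1`!%:R * t * (t^-1 ^+ m.+1 / m.+1`!%:R))); last first.
  rewrite ler_wpM2l ?mulr_ge0 ?ltW//.
  by apply: lt_le_trans h; rewrite ltrDr.
rewrite le_eqVlt; apply/orP; left; apply/eqP; rewrite exprS; field.
by rewrite (gt_eqF t0) pnatr_eq0 -lt0n fact_gt0.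
Qed.

Lemma is_derive_flat m t :
  is_derive t (1 : R) (flat m) (- m%:R * flat m.+1 t + flat m.+2 t).
Proof.
have [t0|t0|->] := ltgtP t 0.
- rewrite !flat_le0 ?ltW// mulr0 addr0.
  apply: (@near_eq_is_derive _ _ _ (cst 0)).
  have : \forall y \near t, y < 0 by exact: lt_nbhsl.
  by apply: filterS => y y0; rewrite flat_le0 ?ltW.
- have fE k (y : R) : 0 < y -> flat k y = y^-1 ^+ k * expR (- y^-1).
    by move=> y0; rewrite /flat y0.
  rewrite !fE//.
  apply: (@near_eq_is_derive _ _ _ (fun y : R => y^-1 ^+ m * expR (- y^-1) : R)).
    have : \forall y \near t, 0 < y by exact: lt_nbhsr.
    by apply: filterS => y y0; rewrite fE.
  have tn0 : t != 0 by rewrite gt_eqF.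
  have dV : is_derive t (1 : R) (fun y : R => y^-1) (- t ^- 2).
    have := @is_deriveV R id t 1 1 tn0 (is_derive_id _ _).
    by rewrite [_ *: _]mulr1.
  have dX : is_derive t (1 : R) (fun y : R => y^-1 ^+ m) 
      ((m%:R * t^-1 ^+ m.-1) *: - t ^- 2).
    by have := @is_deriveX R R (fun y : R => y^-1) m _ _ _ dV; rewrite exprfctE.
  have dE : is_derive t (1 : R) (fun y : R => expR (- y^-1))
      (expR (- t^-1) * t ^- 2).
    apply: (@is_derive1_comp _ expR (fun y => - y^-1)).
    by rewrite -[t ^- 2]opprK; exact: is_deriveN.
  apply: (is_derive_eq (is_deriveM dX dE)).
  rewrite /GRing.scale /=; case: m {dX} => [|m] /=.
    by rewrite !mul0r !expr0 mulr0 !mul1r oppr0 mul0r add0r addr0 exprVn mulrC.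
  rewrite -!exprVn !exprS; ring.
- rewrite !flat_le0// mulr0 addr0.
  (* For [h > 0] the difference quotient at 0 is [flat m.+1 h], which [flat_le] bounds by [c * h];
     for [h < 0] it is 0. *)
  have H : h^-1 *: ((flat m \o shift 0) (h *: 1) - flat m 0) @[h --> 0^'] --> (0 : R).
    apply/cvgr0Pnorm_le => e e0; pose c : R := m.+2`!%:R.
    have c0 : 0 < c by rewrite ltr0n fact_gt0.
    have : \forall h \near (0 : R)^', `|h| < e / c.
      by apply: dnbhs0_lt; rewrite divr_gt0.
    apply: filterS => h /=; rewrite [_ *: 1]mulr1 addr0 (flat_le0 _ (lexx 0)) subr0.
    have [h0 _|h0] := leP h 0; first by rewrite flat_le0// scaler0 normr0 ltW.
    rewrite gtr0_norm// => hc; have -> : h^-1 *: flat m h = flat m.+1 h.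
      by rewrite /flat h0 exprS -mulrA.
    rewrite ger0_norm ?flat_ge0// (le_trans (flat_le _ h0))//.
    by rewrite -ler_pdivlMl// mulrC ltW.
  by apply: DeriveDef; [exact: (cvgP _ H)|exact: (cvg_lim _ H)].
Qed.

(** [Ck] speaks of row vectors, so [flat m] is first treated as a function on ['rV_1], by induction
    on [k] for all [m] at once; composition does the rest. *)
Lemma Ck_flat n k m (U : set 'rV[R]_n) (g : 'rV[R]_n -> R) :
  open U -> Ck k U g -> Ck k U (fun x => flat m (g x)).
Proof.
move=> oU Cg; pose F (y : 'rV[R]_1) : R := flat m (y 0 0).
have df l (y : 'rV[R]_1) : differentiable (fun y : 'rV[R]_1 => flat l (y 0 0)) y.
  apply: (differentiable_comp (f := fun y : 'rV_1 => y 0 0 : R) (g := flat l)).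
    exact: differentiable_coord.
  by apply/derivable1_diffP; case: (is_derive_flat l (y 0 0)).
have CF : Ck k setT F.
  rewrite /F; clear F; elim: k m {Cg} => [|k IH] m /=.
    by move=> y _; exact: differentiable_continuous.
  split=> // v; pose D (y : 'rV[R]_1) : R :=
    v 0 0 * (- m%:R * flat m.+1 (y 0 0) + flat m.+2 (y 0 0)).
  apply: (@Ck_ext _ _ _ setT setT D) => //; first exact: openT.
    move=> y _; rewrite deriveE//.
    have d1 : differentiable (fun y : 'rV[R]_1 => y 0 0 : R) y.
      exact: differentiable_coord.
    have d2 : differentiable (flat m) (y 0 0).
      by apply/derivable1_diffP; case: (is_derive_flat m (y 0 0)).
    rewrite (diff_comp d1 d2) /= -(deriveE _ d1) derive_coord /D.
    have -> : 'd (flat m) (y 0 0) (v 0 0) = v 0 0 * 'd (flat m) (y 0 0) 1.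
      by rewrite -[in LHS](mulr1 (v 0 0)); exact: linearZ.
    rewrite -(deriveE _ d2).
    by rewrite (@derive_val _ _ _ _ _ _ _ (is_derive_flat m (y 0 0))).
  apply: CkM; [exact: openT|exact: Ck_cst|].
  apply: CkD; [exact: openT| |exact: IH].
  by apply: CkM; [exact: openT|exact: Ck_cst|exact: IH].
apply: (@Ck_ext _ _ _ U U (fun x => F (\row_(j < 1) g x))) => //.
  by move=> x _; rewrite /F mxE.
exact: (Ck_comp (V := setT)).
Qed.

Definition step (t : R) : R := flat 0 (2 - t) / (flat 0 (2 - t) + flat 0 (t - 1)).

Lemma step_le1 t : t <= 1 -> step t = 1.
Proof.
move=> t1; rewrite /step (flat_le0 _ (t := t - 1)) ?subr_le0// addr0 divff//.
by rewrite gt_eqF// flat_gt0//; lra.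
Qed.

Lemma step_ge2 t : 2 <= t -> step t = 0.
Proof. by move=> t2; rewrite /step flat_le0 ?mul0r// subr_le0. Qed.

Lemma Ck_step n k (U : set 'rV[R]_n) (g : 'rV[R]_n -> R) :
  open U -> Ck k U g -> Ck k U (fun x => step (g x)).
Proof.
move=> oU Cg.
have C1 : Ck k U (fun x => flat 0 (2 - g x)).
  apply: Ck_flat => //; apply: CkD => //; first exact: Ck_cst.
  apply: (@Ck_ext _ _ _ U U (fun x => -1 * g x)) => //.
    by move=> x _; rewrite mulN1r.
  by apply: CkM => //; exact: Ck_cst.
have C2 : Ck k U (fun x => flat 0 (g x - 1)).
  by apply: Ck_flat => //; apply: CkD => //; exact: Ck_cst.
apply: CkM => //; apply: CkV => //; last exact: CkD.
move=> x _; rewrite gt_eqF//; have [gx|gx] := leP (g x) 1.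
  by rewrite ltr_wpDr ?flat_ge0// flat_gt0//; lra.
by rewrite ltr_wpDl ?flat_ge0// flat_gt0//; lra.
Qed.

Lemma bump_rV n (p : 'rV[R]_n) (A : set 'rV[R]_n) : nbhs p A ->
  exists (f : 'rV[R]_n -> R) (K : set 'rV[R]_n),
    [/\ forall k, Ck k setT f, \forall x \near p, f x = 1, compact K,
        K `<=` A & forall x, ~ K x -> f x = 0].
Proof.
move=> /nbhs_closedballP[d dA].
(* Squares avoid the norm, which is not smooth. The factor [2 / d ^+ 2] makes [q j] reach 2, where
   [step] becomes 0, once coordinate [j] is at distance [d] from that of [p]. *)
pose q (j : 'I_n) (x : 'rV[R]_n) : R :=
  ((x 0 j - p 0 j) * (x 0 j - p 0 j)) * (2 / d%:num ^+ 2).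
have Cq k j : Ck k setT (q j).
  have oT := @openT 'rV[R]_n.
  have Cd : Ck k setT (fun x : 'rV[R]_n => x 0 j - p 0 j).
    by apply: CkD => //; [exact: Ck_coord|exact: Ck_cst].
  by apply: CkM => //; [exact: CkM|exact: Ck_cst].
exists (fun x => \prod_j step (q j x)), [set x | `|x - p| <= d%:num]; split.
- by move=> k; apply: Ck_prod => [|j]; [exact: openT|apply: Ck_step => //; exact: openT].
- have FF : Filter (nbhs p) by exact: nbhs_filter.
  have nq j : \forall x \near p, q j x < 1.
    have cq : q j x @[x --> p] --> q j p by exact: (Cq 0%N j p I).
    have q0 : q j p < 1 by rewrite /q subrr !mul0r ltr01.
    exact: (cvgr_lt (q j p) cq).
  apply: filterS (filter_forall FF nq) => x qx.
  by rewrite big1// => j _; rewrite step_le1// ltW.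
- exact: compact_cball.
- by move=> x /= xp; apply: dA; rewrite closed_ballE// /closed_ball_ /= distrC.
move=> x /= /negP; rewrite -ltNge => xp.
have [j xj] : exists j, d%:num <= `|(x - p) 0 j|.
  apply: contrapT => /forallNP xj; move: xp; rewrite ltNge => /negP; apply.
  apply: row_norm_le => // j; have /negP := xj j; rewrite -ltNge.
  exact: ltW.
rewrite (bigD1 j)//= step_ge2 ?mul0r// /q -expr2 -(real_normK (num_real (x 0 j - p 0 j))).
rewrite mulrCA ler_peMr// ler_pdivlMr ?exprn_gt0// mul1r.
by rewrite ler_sqr ?nnegrE//; move: xj; rewrite !mxE.
Qed.

End Bump.

(** * Smooth spaces *)

Section SmoothSpaces.
Variable R : realType.
Implicit Types M N : smooth_space R.

Lemma smooth_nearP n (x : 'rV[R]_n) (U : set 'rV[R]_n) f :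
  open U -> U x -> (forall k, Ck k U f) -> smooth_near x f.
Proof. by move=> oU Ux Cf; exists U. Qed.

Lemma smooth_near_setT n (x : 'rV[R]_n) f : (forall k, Ck k setT f) -> smooth_near x f.
Proof. by apply: smooth_nearP => //; exact: openT. Qed.

Lemma smooth_near_comp n k (x : 'rV[R]_n) (g : 'I_k -> 'rV[R]_n -> R) F :
  (forall j, smooth_near x (g j)) -> smooth_near (\row_j g j x) F ->
  smooth_near x (fun y => F (\row_j g j y)).
Proof.
move=> /smooth_near_common[U [oU Ux Cg]] [V [oV Vx CF]].
have cg : {in U, continuous (fun y => \row_j g j y)}.
  by move=> y; rewrite inE => Uy; apply: continuous_row => j; exact: (Cg 0%N j).
pose W := U `&` [set y | V (\row_j g j y)].
have oW : open W.
  rewrite openE => y [Uy Vy]; apply: filterI; first exact: open_nbhs_nbhs.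
  by apply: (cg y (mem_set Uy)); exact: open_nbhs_nbhs.
exists W; split => // l; apply: (Ck_comp (V := V)) => //; first by move=> y [].
by move=> j; apply: Ck_sub (Cg l j) => // y [].
Qed.

(* The germs at [x] form a C^oo-ring. This fails for arbitrary smooth spaces, but
   holds for manifolds and for initial spaces. *)
Definition comp_closed M (x : M) : Prop :=
  forall k (g : 'I_k -> M -> R) (F : 'rV[R]_k -> R),
    (forall j, smooth_at x (g j)) -> smooth_near (\row_j g j x) F ->
    smooth_at x (fun y => F (\row_j g j y)).

Lemma smooth_map_at_comp M N (L : smooth_space R) (f : M -> N) (g : N -> L) x :
  smooth_map_at f x -> smooth_map_at g (f x) -> smooth_map_at (g \o f) x.
Proof.
move=> [cf sf] [cg sg]; split; first exact: (continuous_comp cf cg).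
by move=> h /sg/sf.
Qed.

Lemma smooth_map_at_near M N (f g : M -> N) x :
  (\forall y \near x, f y = g y) -> smooth_map_at f x -> smooth_map_at g x.
Proof.
move=> fg [cf sf]; split; first exact: near_eq_continuous cf.
move=> h; rewrite -(nbhs_singleton fg) => /sf; apply: smooth_at_local.
by apply: filterS fg => y /= ->.
Qed.

Lemma chart_comp_closed M n (x : M) (phi : M -> 'rV[R]_n) psi :
  chart_at x phi psi -> comp_closed x.
Proof.
move=> [U [V [Ux [oU oV UV VU]]]] k g F sg sF.
have [Vx psix [cphi sphi]] := UV _ Ux; have [_ _ [_ spsi]] := VU _ Vx.
apply: (@smooth_at_local _ _ _ ((fun v => F (\row_j g j (psi v))) \o phi)).
  by apply: filterS (open_nbhs_nbhs (conj oU Ux)) => y /UV[_ psiy _] /=; rewrite psiy.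
apply: sphi; apply: (smooth_near_comp (g := fun j => g j \o psi)) => /=.
  by move=> j; apply: spsi; rewrite psix.
by under [\row_j _]eq_mx do rewrite psix.
Qed.

Lemma manifold_comp_closed M : manifold M -> forall x : M, comp_closed x.
Proof. by move=> [_ _ Mc] x; have [n [phi [psi]]] := Mc x; exact: chart_comp_closed. Qed.

Section Initial.
Variables (T I : Type) (X : I -> smooth_space R) (f : forall i, T -> X i).

(** The data behind [initial_smooth_at] as a type, so that a presentation, whose size and indices
    may vary, can be picked for each member of a family of germs. *)
Record presentation (t : initial_space f) (h : initial_space f -> R) := Presentation {
  pres_size : nat;
  pres_ix : 'I_pres_size -> I;
  pres_fun : forall l, X (pres_ix l) -> R;
  pres_outer : 'rV[R]_pres_size -> R;
  pres_fun_smooth : forall l, smooth_at (f (pres_ix l) t) (@pres_fun l);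
  pres_outer_smooth :
    smooth_near (\row_l pres_fun (f (pres_ix l) t)) pres_outer;
  presE : \forall s \near t, h s = pres_outer (\row_l pres_fun (f (pres_ix l) s))
}.

Lemma smooth_at_presentation (t : initial_space f) h :
  smooth_at t h -> exists p : presentation t h, True.
Proof. by move=> [k [i [g [F [sg sF hF]]]]]; exists (Presentation sg sF hF). Qed.

(** The inner functions of all presentations are concatenated along the disjoint union [J]. The new
    outer function extracts the block of each [j], applies the outer function of [p j] to it, and
    then applies [F]. *)
Lemma initial_comp_closed (t : initial_space f) : comp_closed t.
Proof.
move=> k g F sg sF.
have p j : presentation t (g j) by exact: (sval (cid (smooth_at_presentation (sg j)))).
pose J := {j : 'I_k & 'I_(pres_size (p j))}.
pose u (a : 'I_#|{: J}|) : J := enum_val a.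
pose ix (q : J) : I := pres_ix (tagged q).
pose gx (q : J) : X (ix q) -> R := @pres_fun _ _ (p (tag q)) (tagged q).
pose G s : 'rV[R]_#|{: J}| := \row_a gx (u a) (f (ix (u a)) s).
pose c j l : J := Tagged (fun j => 'I_(pres_size (p j))) (l : 'I_(pres_size (p j))).
pose sub j (y : 'rV[R]_#|{: J}|) : 'rV[R]_(pres_size (p j)) :=
  \row_l y 0 (enum_rank (c j l)).
have subG j s : sub j (G s) = \row_l pres_fun (f (pres_ix (p := p j) l) s).
  apply/rowP => l; rewrite !mxE /u.
  exact: (congr1 (fun q => gx q (f (ix q) s)) (enum_rankK (c j l))).
exists #|{: J}|, (fun a => ix (u a)), (fun a => gx (u a)).
exists (fun y => F (\row_j pres_outer (p := p j) (sub j y))); split.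
- by move=> a; exact: pres_fun_smooth.
- apply: (smooth_near_comp (g := fun j y => pres_outer (p := p j) (sub j y))) => [j|].
    apply: (smooth_near_comp (g := fun l y => y 0 (enum_rank (c j l)))) => [l|].
      by apply: smooth_near_setT => m; exact: Ck_coord.
    by have := pres_outer_smooth (p j); rewrite -[X in smooth_near X _]subG.
  suff -> : \row_j pres_outer (p := p j) (sub j (G t)) = \row_j g j t by [].
  by apply/rowP => j; rewrite !mxE subG; have /nbhs_singleton-> := presE (p j).
have FF : Filter (nbhs t) by exact: nbhs_filter.
have := filter_forall FF (fun j => presE (p j)).
apply: (@filterS _ _ FF) => s Es; congr F.
by apply/rowP => j; rewrite !mxE Es subG.
Qed.

Lemma smooth_at_ev (t : initial_space f) i (g : X i -> R) :
  smooth_at (f i t) g -> smooth_at t (fun s : initial_space f => g (f i s)).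
Proof.
move=> sg; exists 1%N, (fun=> i), (fun=> g), (fun y => y 0 0); split=> //.
  by apply: smooth_near_setT => k; exact: Ck_coord.
by apply: (@filterS _ _ (nbhs_filter t) setT) => [s _|]; [rewrite mxE|exact: filterT].
Qed.

Lemma ev_smooth i : smooth_map (f i : initial_space f -> X i).
Proof. by move=> t; split; [exact: initial_ev_continuous|exact: smooth_at_ev]. Qed.

(** The universal property of the initial structure: a germ on the target is a smooth function of
    finitely many germs on the components, and [comp_closed] reassembles their pullbacks. *)
Lemma smooth_map_at_initial M (phi : M -> initial_space f) x : comp_closed x ->
  (forall i, smooth_map_at (fun y => f i (phi y)) x) -> smooth_map_at phi x.
Proof.
move=> cx sphi; have cphi : {for x, continuous phi}.
  by apply: initial_continuous_at => i; exact: (sphi i).1.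
split=> // h [k [i [g [F [sg sF hF]]]]].
apply: (@smooth_at_local _ _ _ (fun y => F (\row_j g j (f (i j) (phi y))))).
  by have := cphi _ hF; apply: (@filterS _ _ (nbhs_filter x)) => y /= ->.
apply: (cx _ (fun j y => g j (f (i j) (phi y)))) => // j.
exact: (sphi (i j)).2.
Qed.

End Initial.

Lemma smooth_at_cst M (x : M) (c : R) : comp_closed x -> smooth_at x (fun=> c).
Proof.
move=> cx; apply: (cx 0%N (fun _ _ => 0) (fun=> c)) => [[]//|].
by apply: smooth_near_setT => k; exact: Ck_cst.
Qed.

Lemma smooth_atD M (x : M) f g : comp_closed x ->
  smooth_at x f -> smooth_at x g -> smooth_at x (fun y => f y + g y).
Proof.
move=> cx sf sg.
pose F (v : 'rV[R]_2) : R := v 0 0 + v 0 1.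
rewrite (_ : (fun y => _) = fun y => F (\row_j (if j == 0 then f else g) y)).
  apply: cx => [j|]; first by case: ifP.
  by apply: smooth_near_setT => k; apply: CkD; [exact: openT|exact: Ck_coord|exact: Ck_coord].
by rewrite funeqE => y; rewrite /F !mxE.
Qed.

Lemma smooth_atM M (x : M) f g : comp_closed x ->
  smooth_at x f -> smooth_at x g -> smooth_at x (fun y => f y * g y).
Proof.
move=> cx sf sg.
pose F (v : 'rV[R]_2) : R := v 0 0 * v 0 1.
rewrite (_ : (fun y => _) = fun y => F (\row_j (if j == 0 then f else g) y)).
  apply: cx => [j|]; first by case: ifP.
  by apply: smooth_near_setT => k; apply: CkM; [exact: openT|exact: Ck_coord|exact: Ck_coord].
by rewrite funeqE => y; rewrite /F !mxE.
Qed.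

Lemma smooth_at_sum M (x : M) (J : Type) (r : seq J) (P : pred J) (f : J -> M -> R) :
  comp_closed x -> (forall j, smooth_at x (f j)) ->
  smooth_at x (fun y => \sum_(j <- r | P j) f j y).
Proof.
move=> cx sf; elim: r => [|j r IH].
  by under eq_fun do rewrite big_nil; exact: smooth_at_cst.
by under eq_fun do rewrite big_cons; case: (P j) => //; exact: (smooth_atD cx (sf j) IH).
Qed.

Lemma smooth_at_prod M (x : M) (J : Type) (r : seq J) (P : pred J) (f : J -> M -> R) :
  comp_closed x -> (forall j, smooth_at x (f j)) ->
  smooth_at x (fun y => \prod_(j <- r | P j) f j y).
Proof.
move=> cx sf; elim: r => [|j r IH].
  by under eq_fun do rewrite big_nil; exact: smooth_at_cst.
by under eq_fun do rewrite big_cons; case: (P j) => //; exact: (smooth_atM cx (sf j) IH).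
Qed.

End SmoothSpaces.

(** * Local sections and partitions of unity *)

Section Partition.
Variable R : realType.
Implicit Types M N : smooth_space R.

Lemma smooth_map_at_coord M n (phi : M -> euclidean R n) x j :
  smooth_map_at phi x -> smooth_at x (fun y => phi y 0 j : R).
Proof.
move=> [_ sphi]; apply: (sphi (fun v => v 0 j)).
by apply: smooth_near_setT => k; exact: Ck_coord.
Qed.

Lemma smooth_map_at_euclidean M n (phi : M -> euclidean R n) x : comp_closed x ->
  (forall j, smooth_at x (fun y => phi y 0 j : R)) -> smooth_map_at phi x.
Proof.
move=> cx sphi.
have rowphi y : \row_j phi y 0 j = phi y by apply/rowP => j; rewrite mxE.
split.
  apply: (@near_eq_continuous _ _ (fun y => \row_j (phi y 0 j : R))).
    by apply: filterE => y; exact: rowphi.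
  by apply: continuous_row => j; exact: smooth_at_continuous.
move=> F; rewrite -[phi x]rowphi => /(cx _ (fun j y => phi y 0 j) F sphi).
by apply: smooth_at_local; apply: filterE => y; rewrite /= rowphi.
Qed.

Lemma euclidean_comp_closed n (x : euclidean R n) : comp_closed x.
Proof. by move=> k g F; exact: smooth_near_comp. Qed.

Lemma submersion_section M N (f : M -> N) (y : N) : surjective_submersion f ->
  exists s : N -> M, (forall z, f (s z) = z) /\
    \forall z \near y, smooth_map_at s z.
Proof.
move=> [[sf subf] surjf]; have [x fx] := surjf y; have /choice[t0 ft0] := surjf.
have [m [n [phi [phi' [psi [psi' [cphi cpsi df]]]]]]] := subf x.
have [U [V [Ux [oU oV UV VU]]]] := cphi.
have [U' [V' [Ux' [oU' oV' UV' VU']]]] := cpsi.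
have [Vx phiK sphi] := UV _ Ux; have [_ _ sphi'] := VU _ Vx.
have [Vfx psiK spsi] := UV' _ Ux'.
pose fh : 'rV[R]_m -> 'rV[R]_n := psi \o f \o phi'.
have sfh : smooth_map_at (M := euclidean R m) (N := euclidean R n) fh (phi x).
  apply: (@smooth_map_at_comp _ (euclidean R m) M (euclidean R n) phi' (psi \o f)) => //.
  rewrite phiK; apply: smooth_map_at_comp => //.
have fhx : fh (phi x) = psi y by rewrite /fh /= phiK fx.
have [|s0 [s0x ss0 fs0]] := @submersion_local_section R m n fh (phi x) _ df.
  by move=> j; exact: (smooth_map_at_coord j sfh).
rewrite fhx in s0x ss0 fs0.
have ss0' : smooth_map_at (M := euclidean R n) (N := euclidean R m) s0 (psi y).
  by apply: smooth_map_at_euclidean => //; exact: euclidean_comp_closed.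
pose s := phi' \o s0 \o psi.
rewrite fx in Ux' Vfx psiK spsi.
have cpsiy : {for y, continuous psi} by case: spsi.
have FF : Filter (nbhs y) by exact: nbhs_filter.
have near_s : \forall z \near y, smooth_map_at s z.
  have nss0 : \forall v \near psi y, forall i, smooth_near v (fun z => s0 z 0 i).
    apply: (filter_forall (nbhs_filter (psi y))) => i.
    exact: smooth_near_open.
  have nV : \forall v \near psi y, V (s0 v).
    by apply: (ss0'.1); rewrite s0x; exact: open_nbhs_nbhs.
  have n1 : \forall z \near y, forall i, smooth_near (psi z) (fun v => s0 v 0 i).
    exact: (cpsiy _ nss0).
  have n2 : \forall z \near y, V (s0 (psi z)) by exact: (cpsiy _ nV).
  have n3 : \forall z \near y, U' z by exact: open_nbhs_nbhs.
  apply: (@filterS3 _ _ FF) n1 n2 n3 => z ss0z Vz U'z.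
  have [_ _ spsiz] := UV' _ U'z; have [_ _ sphi'z] := VU _ Vz.
  apply: (@smooth_map_at_comp _ N (euclidean R n) M psi (phi' \o s0)) => //.
  apply: (@smooth_map_at_comp _ (euclidean R n) (euclidean R m) M s0 phi') => //.
  by apply: smooth_map_at_euclidean => //; exact: euclidean_comp_closed.
have sy : s y = x by rewrite /s /= s0x phiK.
(* In charts the equation holds only after applying [psi]. To cancel [psi], which is injective on
   [U'], continuity must first bring [f (s z)] into [U']. *)
have near_fs : \forall z \near y, f (s z) = z.
  have [cs _] := nbhs_singleton near_s; have [cf _] := sf (s y).
  have nU' : \forall z \near y, U' (f (s z)).
    apply: (continuous_comp cs cf); rewrite /= sy fx.
    exact: open_nbhs_nbhs.
  have n1 : \forall z \near y, fh (s0 (psi z)) = psi z by exact: (cpsiy _ fs0).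
  have n2 : \forall z \near y, U' z by exact: open_nbhs_nbhs.
  apply: (@filterS3 _ _ FF) n1 nU' n2 => z fsz U'fs U'z.
  have [_ e _] := UV' _ U'fs; have [_ e' _] := UV' _ U'z.
  by rewrite -e -[RHS]e'; exact: (congr1 psi' fsz).
(* Where [s] fails to be a section an arbitrary preimage replaces it; near [y] this changes
   nothing. *)
exists (fun z => if pselect (f (s z) = z) then s z else t0 z); split.
  by move=> z; case: pselect => h /=; [exact: h|exact: ft0].
have nn : \forall z \near y, \forall w \near z, f (s w) = w by exact: nbhs_interior.
apply: (@filterS2 _ _ FF) near_s nn => z sz fsz; apply: smooth_map_at_near sz.
by apply: filterS fsz => w fsw; case: pselect => h /=.
Qed.

Lemma manifold_bump M (y : M) (A : set M) : manifold M -> nbhs y A ->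
  exists b : M -> R, [/\ smooth_function b, \forall z \near y, b z = 1 &
    forall z, A z \/ \forall w \near z, b w = 0].
Proof.
move=> mM Ay; have [hM _ Mc] := mM; have [n [phi [psi [U [V [Uy [oU oV UV VU]]]]]]] := Mc y.
have [Vy psiK [cphi _]] := UV _ Uy; have [_ _ [cpsi _]] := VU _ Vy.
have nA : nbhs (phi y) (V `&` psi @^-1` A).
  apply: filterI; first exact: open_nbhs_nbhs.
  by apply: cpsi; rewrite psiK.
have [beta [K [Cb b1 cK KVA b0]]] := bump_rV nA.
have cC : compact (psi @` K).
  apply: continuous_compact => //; apply: continuous_in_subspaceT => v.
  by rewrite inE => /KVA[Vv _]; have [_ _ []] := VU _ Vv.
have oC : open (~` (psi @` K)).
  by apply: closed_openC; exact: compact_closed.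
pose b z := if pselect (U z) then beta (phi z) else 0.
have bC z : (~` (psi @` K)) z -> b z = 0.
  move=> Cz; rewrite /b; case: pselect => // Uz; apply: b0 => Kz; apply: Cz.
  by exists (phi z) => //; have [] := UV _ Uz.
have nbC z : (~` (psi @` K)) z -> \forall w \near z, b w = 0.
  by move=> Cz; apply: filterS bC _; exact: open_nbhs_nbhs.
have bU z : U z -> \forall w \near z, beta (phi w) = b w.
  move=> Uz; apply: filterS (open_nbhs_nbhs (conj oU Uz)) => w Uw.
  by rewrite /b; case: pselect => h /=.
exists b; split.
- move=> z; have [Uz|nUz] := pselect (U z).
    apply: smooth_at_local (bU _ Uz) _; have [_ _ [_ sphi]] := UV _ Uz.
    by apply: (sphi beta); exact: smooth_near_setT.
  apply: (@smooth_at_local _ _ _ (fun=> 0)).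
    have /nbC : (~` (psi @` K)) z.
      by move=> [v /KVA[Vv _] e]; apply: nUz; rewrite -e; have [] := VU _ Vv.
    by apply: filterS => w ->.
  by apply: smooth_at_cst; apply: manifold_comp_closed.
- have n1 : \forall z \near y, beta (phi z) = 1 by exact: (cphi _ b1).
  by apply: (@filterS2 _ _ (nbhs_filter y)) (bU _ Uy) n1 => z <-.
- move=> z; have [[v Kv <-]|Cz] := pselect ((psi @` K) z); last by right; exact: nbC.
  by left; have [] := KVA _ Kv.
Qed.

(* [rho k = b k * \prod_(j < k) (1 - b j)] for bumps [b k] whose plateaus cover
   [M]: the partial sums [1 - \prod_(j < k) (1 - b j)] telescope, and on a plateau
   of [b k] all later terms vanish. So countably many bumps suffice, and no
   locally finite refinement is needed. *)
Lemma partition_of_unity M (A : M -> set M) : manifold M -> (forall y, nbhs y (A y)) ->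
  exists (i : nat -> option M) (rho : nat -> M -> R),
    [/\ forall k, smooth_function (rho k),
        forall k (z : M), (exists2 y, i k = Some y & A y z) \/ \forall w \near z, rho k w = 0 &
        forall z : M, exists m, \forall w \near z,
          (forall k, (m <= k)%N -> rho k w = 0) /\ \sum_(k < m) rho k w = 1].
Proof.
move=> hM nA; have /choice[b bP] y := manifold_bump hM (nA y).
have [_ [B [/countable_injP[e einj] [oB basB]]] _] := hM.
pose good (W : set M) y := forall z, W z -> b y z = 1.
(* Basic open sets inside some plateau cover [M]. Choosing one plateau for each of them, indexed
   through the injection [e], makes the family of bumps countable. *)
have /choice[i iP] k : exists o : option M, forall W, B W -> e W = k ->
    (exists y, good W y) -> exists2 y, o = Some y & good W y.
  have [[W [BW eW [y Wy]]]|no] :=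
      pselect (exists W, [/\ B W, e W = k & exists y, good W y]).
    exists (Some y) => W' BW' eW' _; exists y => //.
    suff -> : W' = W by [].
    by apply: einj; rewrite ?inE// eW.
  by exists None => W BW eW Wy; case: no; exists W.
pose b' k z := if i k is Some y then b y z else 0.
have sb' k : smooth_function (b' k).
  rewrite /b' => z; case: (i k) => [y|]; first by have [] := bP y.
  by apply: smooth_at_cst; exact: manifold_comp_closed.
pose rho k z := b' k z * \prod_(j < k) (1 + -1 * b' j z).
have sum_rho m z : \sum_(k < m) rho k z = 1 - \prod_(k < m) (1 + -1 * b' k z).
  elim: m => [|m IH]; first by rewrite !big_ord0 subrr.
  by rewrite !big_ord_recr /= IH /rho; ring.
exists i, rho; split.
- move=> k z; have cz : comp_closed z by exact: manifold_comp_closed.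
  apply: smooth_atM => //; first exact: sb'.
  apply: smooth_at_prod => // j; apply: smooth_atD => //; first exact: smooth_at_cst.
  by apply: smooth_atM => //; [exact: smooth_at_cst|exact: sb'].
- move=> k z; rewrite /rho /b'; case: (i k) => [y|]; last first.
    by right; apply: nearW => w; rewrite mul0r.
  have [_ _ /(_ z)[Az|b0]] := bP y; first by left; exists y.
  by right; apply: filterS b0 => w ->; rewrite mul0r.
move=> z; have [_ bz _] := bP z; have := basB z.
move=> /(_ _ bz)[W [BW Wz] Wb].
have [y iy Wy] := iP (e W) W BW erefl (ex_intro _ z Wb).
(* The successor brings in the factor [1 - b' (e W)], which is 0 on [W]; from there on every product
   vanishes. *)
exists (e W).+1; have : \forall w \near z, W w.
  by apply: open_nbhs_nbhs; split => //; exact: oB.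
apply: filterS => w Ww; have b1 : b' (e W) w = 1 by rewrite /b' iy; exact: Wy.
have p0 k : (e W < k)%N -> \prod_(j < k) (1 + -1 * b' j w) = 0.
  by move=> ek; rewrite (bigD1 (Ordinal ek))//= b1 mulN1r subrr mul0r.
by split=> [k ek|]; [rewrite /rho p0 ?mulr0|rewrite sum_rho p0 ?subr0].
Qed.

(* The [s k] are sections everywhere, but need only be smooth on the support of
   [rho k]. *)
Lemma averaged_sections M N (f : M -> N) : manifold N -> surjective_submersion f ->
  exists (s : nat -> N -> M) (rho : nat -> N -> R),
    [/\ forall k z, f (s k z) = z, forall k, smooth_function (rho k),
        forall k (z : N), smooth_map_at (s k) z \/ \forall w \near z, rho k w = 0 &
        forall z : N, exists m, \forall w \near z,
          (forall k, (m <= k)%N -> rho k w = 0) /\ \sum_(k < m) rho k w = 1].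
Proof.
move=> mN sf; have /choice[s sP] y := submersion_section y sf.
have /choice[t0 ft0] := sf.2.
have [|i [rho [srho rho0 rho1]]] := @partition_of_unity N
  (fun y z => smooth_map_at (s y) z) mN; first by move=> y; case: (sP y).
exists (fun k z => if i k is Some y then s y z else t0 z), rho; split => //.
  by move=> k z; case: (i k) => // y; case: (sP y).
by move=> k z; have [[y -> sy]|r0] := rho0 k z; [left|right].
Qed.

End Partition.

(** * Simplices of the pullback along a hypercover *)

Section Lifting.
Variables (R : realType) (G H : lie_groupoid R) (phi : lie_morphism G H).
Hypothesis hphi : hypercover phi.
Variable V : higher_vector_bundle (nerve H).

Local Notation pbV := (pullback (nerve_map phi) (Defs.proj V)).

Lemma hypercover_arrow_inj g g' : src g = src g' -> tgt g = tgt g' ->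
  mar phi g = mar phi g' -> g = g'.
Proof.
move=> es et em; have [_ [q [_ _ qK _]]] := hphi.
have [_ <- _] := qK g I; have [_ <- _] := qK g' I; congr q.
by apply: sval_inj; rewrite /hypercover_square /= es et em.
Qed.

Lemma hypercover_arrow x y h : mob phi x = src h -> mob phi y = tgt h ->
  exists g, [/\ src g = x, tgt g = y & mar phi g = h].
Proof.
move=> ex ey; have [_ [q [_ _ _ qK]]] := hphi.
have e : (mob phi (y, x).1, mob phi (y, x).2) = (tgt h, src h) by rewrite /= ex ey.
have [_ + _] := qK (exist _ ((y, x), h) e) I.
by move=> [? ? ?]; exists (q (exist _ ((y, x), h) e)).
Qed.

(** Arrows are lifted one at a time. The functor laws follow because an arrow of [G] is determined
    by its endpoints and its image in [H]. *)
Lemma hypercover_chain n (c : nerve H n) (x : 'I_n.+1 -> ob G) :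
  (forall i, mob phi (x i) = chain_ob c i) ->
  exists2 d : nerve G n, chain_ob d = x & nerve_map phi n d = c.
Proof.
move=> ex.
have arP i j (ij : (i <= j)%O) : exists g : ar G,
    [/\ src g = x i, tgt g = x j & mar phi g = chain_ar c ij].
  by apply: hypercover_arrow; rewrite ?chain_src ?chain_tgt.
pose a i j ij := sval (cid (arP i j ij)).
have aP i j ij : [/\ src (a i j ij) = x i, tgt (a i j ij) = x j &
    mar phi (a i j ij) = chain_ar c ij] by exact: (svalP (cid (arP i j ij))).
have a1 i (ii : (i <= i)%O) : a i i ii = Defs.one (x i).
  have [es et em] := aP i i ii; apply: hypercover_arrow_inj.
  - by rewrite es src_one.
  - by rewrite et tgt_one.
  - by rewrite em mar_one chain_one ex.
have aM i j k (ij : (i <= j)%O) (jk : (j <= k)%O) (ik : (i <= k)%O)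
    (e : src (a j k jk) = tgt (a i j ij)) : Defs.comp e = a i k ik.
  have [es et em] := aP i j ij; have [es' et' em'] := aP j k jk.
  have [es'' et'' em''] := aP i k ik; apply: hypercover_arrow_inj.
  - by rewrite src_comp es es''.
  - by rewrite tgt_comp et' et''.
  - have e' : src (mar phi (a j k jk)) = tgt (mar phi (a i j ij)).
      by rewrite mar_src mar_tgt e.
    rewrite (mar_comp e e') em''; move: e'; rewrite em em' => e'.
    exact: chain_comp.
pose d : nerve G n := Chain (fun i j ij => let: And3 h _ _ := aP i j ij in h)
  (fun i j ij => let: And3 _ h _ := aP i j ij in h) a1 aM.
exists d => //; apply: chain_eq => [i|i j ij] /=; first exact: ex.
by have [] := aP i j ij.
Qed.

Definition vertex n (v : Defs.total V n) (i : 'I_n.+1) : ob H := chain_ob (Defs.proj V n v) i.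

Definition pull_vertex n (w : pbV n) (i : 'I_n.+1) : ob G := chain_ob (pull_proj w) i.

Lemma vertex_act m n (a : {omorphism 'I_m.+1 -> 'I_n.+1}) (v : Defs.total V n) i :
  vertex (act a v) i = vertex v (a i).
Proof. by rewrite /vertex smap_act. Qed.

Lemma mob_pull_vertex n (w : pbV n) i :
  mob phi (pull_vertex w i) = vertex (pull_canon w) i.
Proof. by case: w => -[d v] /= e; rewrite /vertex /pull_canon /= -e. Qed.

Lemma pull_lift n (v : Defs.total V n) (x : 'I_n.+1 -> ob G) :
  (forall i, mob phi (x i) = vertex v i) ->
  exists w : pbV n, pull_vertex w = x /\ pull_canon w = v.
Proof.
by move=> /hypercover_chain[d dx dv]; exists (exist _ (d, v) dv).
Qed.

Lemma pull_lift_unique n (w w' : pbV n) : pull_vertex w = pull_vertex w' ->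
  pull_canon w = pull_canon w' -> w = w'.
Proof.
case: w w' => -[d v] /= e [[d' v'] /= e']; rewrite /pull_vertex /pull_canon /=.
move=> dd vv; apply: sval_inj => /=; congr pair => //.
have ddi i : chain_ob d i = chain_ob d' i by exact: (congr1 (@^~ i) dd).
apply: chain_eq => [//|i j ij].
apply: hypercover_arrow_inj; rewrite ?chain_src ?chain_tgt//.
have -> : mar phi (chain_ar d ij) = chain_ar (nerve_map phi n d) ij by [].
have -> : mar phi (chain_ar d' ij) = chain_ar (nerve_map phi n d') ij by [].
have -> // : nerve_map phi n d = nerve_map phi n d'.
by have := e; rewrite vv -e'.
Qed.

Lemma pull_lift_smooth (M : smooth_space R) n (W : M -> pbV n) (x : M) :
  comp_closed x ->
  (forall i, smooth_map_at (fun y => pull_vertex (W y) i) x) ->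
  smooth_map_at (fun y => pull_canon (W y)) x -> smooth_map_at W x.
Proof.
move=> cx sv sc; apply: smooth_map_at_initial => // -[|] /=; last exact: sc.
apply: smooth_map_at_initial => // -[i|p] /=; first exact: sv.
have [_ [q [_ _ qK qK']]] := hphi.
pose a (y : M) := chain_ar (sval (W y)).1 (svalP p).
(* Each arrow of the lift is the value of the smooth inverse [q] at its endpoints and its image in
   [H], and these depend smoothly on [y]. *)
have -> : (fun y => chain_ar (sval (W y)).1 (svalP p)) =
          q \o (fun y => hypercover_square phi (a y)).
  by apply/funext => y /=; have [_ -> _] := qK (a y) I.
apply: smooth_map_at_comp; last by have [_ _] := qK' (hypercover_square phi (a x)) I.
apply: smooth_map_at_initial => // -[|] /=.
  apply: smooth_map_at_initial => // -[|] /=.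
    by under eq_fun do rewrite chain_tgt; exact: sv.
  by under eq_fun do rewrite chain_src; exact: sv.
have -> : (fun y => mar phi (a y)) =
    (fun c : nerve H n => chain_ar c (svalP p)) \o
      (Defs.proj V n \o (fun y => pull_canon (W y))).
  apply/funext => y /=; rewrite /a; case: (W y) => -[d v] /= e.
  by rewrite /pull_canon /= -e.
apply: smooth_map_at_comp; last exact: (@ev_smooth _ _ _ _ _ (inr p)).
apply: smooth_map_at_comp => //; exact: smap_smooth.
Qed.

(* The value of [c] at the simplex over [v] with vertices [x], and [0] if the
   vertices do not match. *)
Definition ev_lift n (c : pbV n -> R) (x : 'I_n.+1 -> ob G) (v : Defs.total V n) : R :=
  xget 0 [set r | exists w, [/\ pull_vertex w = x, pull_canon w = v & c w = r]].

Lemma ev_liftE n (c : pbV n -> R) (w : pbV n) :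
  ev_lift c (pull_vertex w) (pull_canon w) = c w.
Proof.
apply: xget_subset1; first by exists w.
by move=> r r' [w1 [h1 k1 <-]] [w2 [h2 k2 <-]]; congr c;
  apply: pull_lift_unique; [rewrite h1 h2|rewrite k1 k2].
Qed.

Lemma ev_lift_smooth (M : smooth_space R) n (c : pbV n -> R)
    (x : 'I_n.+1 -> M -> ob G) (v : M -> Defs.total V n) (y : M) :
  comp_closed y -> smooth_function c ->
  (forall z i, mob phi (x i z) = vertex (v z) i) ->
  (forall i, smooth_map_at (x i) y) -> smooth_map_at v y ->
  smooth_at y (fun z => ev_lift c (x^~ z) (v z)).
Proof.
move=> cy sc xv sx sv; have /choice[W WP] z := pull_lift (xv z).
have -> : (fun z => ev_lift c (x^~ z) (v z)) = c \o W.
  by apply/funext => z /=; have [<- <-] := WP z; rewrite ev_liftE.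
suff [_ sW] : smooth_map_at W y by exact/sW/sc.
apply: pull_lift_smooth => //.
  move=> i; have -> : (fun z => pull_vertex (W z) i) = x i; last exact: sx.
  by apply/funext => z; have [-> _] := WP z.
by have -> : (fun z => pull_canon (W z)) = v; first
  by apply/funext => z; have [_ ->] := WP z.
Qed.

(** The lifted chain [d] is determined by [x] and [act a b], hence is the same for all vectors over
    [b]. So the function is [c] on one fibre of the pullback, composed with the linear map [L] that
    [a] induces on fibres. *)
Lemma ev_lift_linear m n (a : {omorphism 'I_m.+1 -> 'I_n.+1}) (c : pbV m -> R)
    (x : 'I_m.+1 -> ob G) (b : nerve H n) :
  (forall d, scalar (fun v => c (pull_inc (L := fibres V m) (x := d) v))) ->
  (forall i, mob phi (x i) = chain_ob b (a i)) ->
  scalar (fun v => ev_lift c x (act a (inc (fibres V n) b v))).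
Proof.
move=> lc xb; have [L Lact] := act_linear V a b.
have [d dx db] : exists2 d : nerve G m, chain_ob d = x & nerve_map phi m d = act a b.
  exact: hypercover_chain.
move: L Lact; rewrite -db => L Lact.
have E v : ev_lift c x (act a (inc (fibres V n) b v)) =
           c (pull_inc (L := fibres V m) (x := d) (L v)).
  by rewrite Lact -ev_liftE -dx.
by move=> r u v; rewrite !E linearP; exact: lc.
Qed.

End Lifting.

(** * Averages over independent random indices *)

Section Average.
Variables (R : realType) (N : smooth_space R) (rho : nat -> N -> R).

(** The expectation truncated to indices at most [m]. The type ['I_m.+1] is inhabited, which allows
    [inord] when the cutoff changes. *)
Definition partial_avg m n (y : 'I_n -> N) (F : ('I_n -> nat) -> R) : R :=
  \sum_(a : {ffun 'I_n -> 'I_m.+1}) (\prod_i rho (a i) (y i)) * F (fun i => a i).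

Lemma partial_avg_widen m m' n (y : 'I_n -> N) F : (m <= m')%N ->
  (forall i k, (m < k)%N -> rho k (y i) = 0) ->
  partial_avg m' y F = partial_avg m y F.
Proof.
move=> mm' y0; rewrite /partial_avg.
rewrite (bigID (fun a : {ffun 'I_n -> 'I_m'.+1} => [forall i, a i <= m]%N))/=.
rewrite addrC big1 ?add0r; last first.
  move=> a /forallPn[i]; rewrite -ltnNge => mi.
  by rewrite (bigD1 i)//= y0// !mul0r.
pose h (a : {ffun 'I_n -> 'I_m.+1}) : {ffun 'I_n -> 'I_m'.+1} :=
  [ffun i => inord (a i)].
pose h' (a : {ffun 'I_n -> 'I_m'.+1}) : {ffun 'I_n -> 'I_m.+1} :=
  [ffun i => inord (a i)].
have hE a i : h a i = a i :> nat.
  by rewrite ffunE inordK// (leq_trans (ltn_ord _)).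
have h'E a i : h' a i = inord (a i) by rewrite ffunE.
rewrite (reindex_onto h h'); last first.
  move=> a /forallP am; apply/ffunP => i; apply/val_inj; rewrite /= hE h'E inordK//.
  by rewrite ltnS; exact: am.
apply: eq_big => [a|a _].
  have -> : [forall i, (h a i <= m)%N] by apply/forallP => i; rewrite hE -ltnS.
  by apply/eqP/ffunP => i; apply/val_inj; rewrite h'E /= inordK hE.
congr (_ * F _); first by apply: eq_bigr => i _; rewrite hE.
by apply/funext => i; rewrite hE.
Qed.

(** The bijection [h] separates the index at [j] from the others. As [F] ignores that index, its
    weights factor out and add up to 1. *)
Lemma partial_avg_lift m n (y : 'I_n.+1 -> N) (j : 'I_n.+1) F :
  \sum_(k < m.+1) rho k (y j) = 1 ->
  partial_avg m y (fun a => F (fun i => a (lift j i))) =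
  partial_avg m (fun i => y (lift j i)) F.
Proof.
move=> y1; rewrite /partial_avg.
pose h (p : 'I_m.+1 * {ffun 'I_n -> 'I_m.+1}) : {ffun 'I_n.+1 -> 'I_m.+1} :=
  [ffun i => if unlift j i is Some i' then p.2 i' else p.1].
pose h' (a : {ffun 'I_n.+1 -> 'I_m.+1}) : 'I_m.+1 * {ffun 'I_n -> 'I_m.+1} :=
  (a j, [ffun i => a (lift j i)]).
have hj p : h p j = p.1 by rewrite ffunE unlift_none.
have hl p i : h p (lift j i) = p.2 i by rewrite ffunE liftK.
rewrite (reindex h)/=; last first.
  exists h' => [[k b] _|a _].
    by congr pair; [exact: hj|apply/ffunP => i; rewrite ffunE; exact: hl].
  by apply/ffunP => i; rewrite ffunE; case: unliftP => [i' ->|->]; rewrite /= ?ffunE.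
transitivity (\sum_(k < m.+1) \sum_(b : {ffun 'I_n -> 'I_m.+1})
    rho k (y j) * ((\prod_i rho (b i) (y (lift j i))) * F (fun i => b i))).
  rewrite pair_big /=; apply: eq_bigr => p _.
  rewrite (bigD1_ord j)//= hj -mulrA; congr (_ * (_ * F _)).
    by apply: eq_bigr => i _; rewrite hl.
  by apply/funext => i; rewrite hl.
rewrite exchange_big; apply: eq_bigr => b _.
by rewrite -mulr_suml y1 mul1r.
Qed.

Hypothesis rho1 : forall z : N, exists m, \forall w \near z,
  (forall k, (m <= k)%N -> rho k w = 0) /\ \sum_(k < m) rho k w = 1.

Definition avg_bound z : nat := sval (cid (rho1 z)).

Lemma avg_bound_near z m : (avg_bound z <= m)%N ->
  \forall w \near z, forall k, (m < k)%N -> rho k w = 0.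
Proof.
move=> zm; apply: filterS (svalP (cid (rho1 z))) => w [w0 _] k mk; apply: w0.
by apply: leq_trans zm _; exact: ltnW.
Qed.

Lemma sum_avg_bound z m : (avg_bound z <= m)%N -> \sum_(k < m.+1) rho k z = 1.
Proof.
move=> zm; have [z0 z1] := nbhs_singleton (svalP (cid (rho1 z))).
rewrite -{}z1 -(big_mkord xpredT (fun k => rho k z)).
rewrite (@big_cat_nat _ _ _ (avg_bound z))//=; last exact: leqW.
rewrite big_mkord [X in _ + X]big_nat [X in _ + X]big1 ?addr0// => k /andP[zk _].
exact: z0.
Qed.

(* The expectation of [F a], where the [a i] are independent and [a i] has the
   law [rho _ (y i)], which is finitely supported. *)
Definition avg n (y : 'I_n -> N) (F : ('I_n -> nat) -> R) : R :=
  partial_avg (\max_i avg_bound (y i)) y F.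

(** The cutoff in [avg] depends on [y] without any continuity. This lemma replaces it by a fixed one
    in a neighbourhood; both are compared with their maximum. *)
Lemma avgE m n (y : 'I_n -> N) F :
  (forall i k, (m < k)%N -> rho k (y i) = 0) -> avg y F = partial_avg m y F.
Proof.
move=> y0; rewrite /avg -(@partial_avg_widen m (maxn m (\max_i avg_bound (y i)))) ?leq_maxl//.
rewrite -(@partial_avg_widen _ (maxn m (\max_i avg_bound (y i))) _ _ _ (leq_maxr _ _))//.
move=> i; apply: (nbhs_singleton (avg_bound_near _)).
exact: (leq_bigmax (F := fun i => avg_bound (y i))).
Qed.

Lemma avg_lift n (y : 'I_n.+1 -> N) (j : 'I_n.+1) F :
  avg (fun i => y (lift j i)) F = avg y (fun a => F (fun i => a (lift j i))).
Proof.
rewrite /avg partial_avg_lift; last first.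
  by apply: sum_avg_bound; exact: (leq_bigmax (F := fun i => avg_bound (y i))).
apply: avgE => i; apply: (nbhs_singleton (avg_bound_near _)).
exact: (leq_bigmax (F := fun i => avg_bound (y i))).
Qed.

Lemma avg_cst n (y : 'I_n -> N) (r : R) : avg y (fun=> r) = r.
Proof.
elim: n y => [|n IH] y.
  rewrite /avg /partial_avg (big_pred1 [ffun i => ord0]) ?big_ord0 ?mul1r//.
  by move=> a; apply/esym/eqP/ffunP => -[].
by rewrite -(avg_lift y ord0 (fun=> r)) IH.
Qed.

Lemma avg_linear n (y : 'I_n -> N) r F F' :
  avg y (fun a => r * F a + F' a) = r * avg y F + avg y F'.
Proof.
rewrite /avg /partial_avg mulr_sumr -big_split; apply: eq_bigr => a _ /=.
by rewrite mulrDr mulrCA.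
Qed.

Lemma avg_sum n (y : 'I_n -> N) p (r : 'I_p -> R) (F : 'I_p -> ('I_n -> nat) -> R) :
  avg y (fun a => \sum_i r i * F i a) = \sum_i r i * avg y (F i).
Proof.
elim: p r F => [|p IH] r F.
  by rewrite big_ord0; under eq_fun do rewrite big_ord0; rewrite avg_cst.
rewrite big_ord_recl -IH -avg_linear; congr (avg y _); apply/funext => a.
by rewrite big_ord_recl.
Qed.

(** Near [x] a fixed cutoff makes the average a finite sum. In each term either all indices satisfy
    [P], so that [F] is smooth, or one weight vanishes near [x] and the term with it. Below, [P k z]
    says that [s k] is smooth at [z]. *)
Lemma avg_smooth (M : smooth_space R) n (y : 'I_n -> M -> N) (P : nat -> N -> Prop)
    (F : M -> ('I_n -> nat) -> R) (x : M) :
  comp_closed x -> (forall k, smooth_function (rho k)) ->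
  (forall k (z : N), P k z \/ \forall w \near z, rho k w = 0) ->
  (forall i, smooth_map_at (y i) x) ->
  (forall a, (forall i, P (a i) (y i x)) -> smooth_at x (fun z => F z a)) ->
  smooth_at x (fun z => avg (y^~ z) (F z)).
Proof.
move=> cx srho P0 sy sF; pose m := \max_i avg_bound (y i x).
have FF : Filter (nbhs x) by exact: nbhs_filter.
have near_m i : \forall z \near x, forall k, (m < k)%N -> rho k (y i z) = 0.
  have mi : (avg_bound (y i x) <= m)%N.
    exact: (leq_bigmax (F := fun i => avg_bound (y i x))).
  have [cy _] := sy i; exact: (cy _ (avg_bound_near mi)).
apply: (@smooth_at_local _ _ _ (fun z => partial_avg m (y^~ z) (F z))).
  by apply: filterS (filter_forall FF near_m) => z zm; rewrite (@avgE m).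
apply: smooth_at_sum => // a.
have [Pa|/existsNP[i nPi]] := pselect (forall i, P (a i) (y i x)).
  apply: smooth_atM; [by []| |exact: sF].
  apply: smooth_at_prod => // i; have [_ s] := sy i.
  exact: (s (rho (a i)) (srho _ _)).
have [//|ri0] := P0 (a i) (y i x).
apply: (@smooth_at_local _ _ _ (fun=> 0)); last exact: smooth_at_cst.
have [cy _] := sy i; have ri : \forall z \near x, rho (a i) (y i z) = 0 by exact: (cy _ ri0).
by apply: filterS ri => z rz; rewrite (bigD1 i)//= rz !mul0r.
Qed.

End Average.

(* [T i j] stands for the [j]-th face of the [i]-th simplex of a prism and [D i j]
   for the [i]-th simplex of the prism over the [j]-th face. *)
Lemma prism_sum (R : comRingType) n (T D : nat -> nat -> R) :
  (forall i j, (j <= i)%N -> (i < n)%N -> T i.+1 j = D i j) ->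
  (forall i j, (i < j)%N -> (j <= n)%N -> T i j.+1 = D i j) ->
  (forall i, (i < n)%N -> T i.+1 i.+1 = T i i.+1) ->
  \sum_(0 <= i < n.+1) \sum_(0 <= j < n.+2) (-1) ^+ (i + j) * T i j +
  \sum_(0 <= i < n) \sum_(0 <= j < n.+1) (-1) ^+ (i + j) * D i j =
  T 0 0 - T n n.+1.
Proof.
move=> TD1 TD2 TT.
(* Row [i] of [D] splits at the diagonal: [P i] cancels against row [i.+1] of [T], and [Q i] against
   row [i]. Only [T i i - T i i.+1] remains of each row, and these differences telescope by [TT]. *)
pose P i := \sum_(0 <= j < i.+1) (-1) ^+ (i + j) * D i j.
pose Q i := \sum_(i.+1 <= j < n.+1) (-1) ^+ (i + j) * D i j.
have row_D i : (i < n)%N -> \sum_(0 <= j < n.+1) (-1) ^+ (i + j) * D i j = P i + Q i.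
  by move=> ni; rewrite (@big_cat_nat _ _ _ i.+1)//= ltnS ltnW.
have row_T i : (i <= n)%N -> \sum_(0 <= j < n.+2) (-1) ^+ (i + j) * T i j =
    (if i is i'.+1 then - P i' else 0) + T i i - T i i.+1 - Q i.
  move=> ni; rewrite (@big_cat_nat _ _ _ i)//=; last by rewrite leqW// leqW.
  rewrite [X in _ + X]big_ltn; last by rewrite ltnS leqW.
  rewrite [X in _ + (_ + X)]big_ltn; last by rewrite !ltnS.
  rewrite addnn -signr_odd odd_double expr0 mul1r.
  rewrite addnS addnn exprS -[(-1) ^+ i.*2]signr_odd odd_double expr0 mulr1 mulN1r.
  rewrite !addrA; congr (_ + _ - _ + _).
    case: i ni => [|i] ni; first by rewrite big_geq.
    rewrite -sumrN; apply: eq_big_nat => j /andP[_ ji].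
    by rewrite TD1// addSn exprS mulN1r mulNr.
  rewrite big_add1 /= -sumrN; apply: eq_big_nat => j /andP[ij jn].
  by rewrite TD2// addnS exprS mulN1r mulNr.
have -> : \sum_(0 <= i < n.+1) \sum_(0 <= j < n.+2) (-1) ^+ (i + j) * T i j =
    \sum_(0 <= i < n.+1)
      ((if i is i'.+1 then - P i' else 0) + T i i - T i i.+1 - Q i).
  by apply: eq_big_nat => i /andP[_ ni]; exact: row_T.
have -> : \sum_(0 <= i < n) \sum_(0 <= j < n.+1) (-1) ^+ (i + j) * D i j =
    \sum_(0 <= i < n) (P i + Q i).
  by apply: eq_big_nat => i /andP[_ ni]; exact: row_D.
have Qn : Q n = 0 by rewrite /Q big_geq.
have rearrange m : (m <= n)%N -> \sum_(0 <= i < m.+1)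
      ((if i is i'.+1 then - P i' else 0) + T i i - T i i.+1 - Q i) +
    \sum_(0 <= i < m) (P i + Q i) = T 0%N 0%N - T m m.+1 - Q m.
  elim: m => [|m IH] mn; first by rewrite big_nat1 big_geq// addr0 add0r.
  rewrite big_nat_recr//= [X in _ + X]big_nat_recr//= addrACA IH ?(ltnW mn)//.
  by rewrite TT//; ring.
by rewrite rearrange// Qn subr0.
Qed.

(** * The chain homotopy *)

Section Codegeneracy.
Variables (n : nat) (i : 'I_n.+1).

Definition codegeneracy_fun (j : 'I_n.+2) : 'I_n.+1 := inord (j - (i < j)).

Lemma codegeneracy_funE (j : 'I_n.+2) : codegeneracy_fun j = (j - (i < j))%N :> nat.
Proof. by rewrite inordK//; have := ltn_ord i; have := ltn_ord j; lia. Qed.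

Lemma codegeneracy_homo : {homo codegeneracy_fun : j k / (j <= k)%O}.
Proof. by move=> j k; rewrite !leEord !codegeneracy_funE; lia. Qed.

HB.instance Definition _ :=
  Order.isOrderMorphism.Build _ 'I_n.+2 _ 'I_n.+1 codegeneracy_fun codegeneracy_homo.

Definition codegeneracy : {omorphism 'I_n.+2 -> 'I_n.+1} := codegeneracy_fun.

End Codegeneracy.

Lemma omorphism_eq m n (a b : {omorphism 'I_m.+1 -> 'I_n.+1}) :
  (forall i : 'I_m.+1, (a i : 'I_n.+1) = b i) -> a = b.
Proof.
move=> /funext; case: a => a [[ha]]; case: b => b [[hb]] /= e.
by case: _ / e in hb *; rewrite (Prop_irrelevance ha hb).
Qed.

Section Descent.
Variables (R : realType) (G H : lie_groupoid R) (phi : lie_morphism G H).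
Hypothesis hphi : hypercover phi.
Variable V : higher_vector_bundle (nerve H).
Variables (s : nat -> ob H -> ob G) (rho : nat -> ob H -> R).
Hypothesis sK : forall k z, mob phi (s k z) = z.
Hypothesis smooth_rho : forall k, smooth_function (rho k).
Hypothesis smooth_s : forall k (z : ob H),
  smooth_map_at (s k) z \/ \forall w \near z, rho k w = 0.
Hypothesis rho1 : forall z : ob H, exists m, \forall w \near z,
  (forall k, (m <= k)%N -> rho k w = 0) /\ \sum_(k < m) rho k w = 1.

Local Notation pbV := (pullback (nerve_map phi) (Defs.proj V)).
Local Notation vV := (Defs.total V).
Local Notation pb_fibres := (fun n => pull_fibres (nerve_map phi) (fibres V n)).

Definition sections n (v : vV n) (a : 'I_n.+1 -> nat) (i : 'I_n.+1) : ob G :=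
  s (a i) (vertex v i).

Lemma mob_sections n (v : vV n) a i : mob phi (sections v a i) = vertex v i.
Proof. exact: sK. Qed.

(* The vertices of the simplex [(f, e) : [m] -> [n] x [1]] of the prism from [w]
   to its image under the random section. *)
Definition cell n (w : pbV n) (a : 'I_n.+1 -> nat) m (f : {omorphism 'I_m.+1 -> 'I_n.+1})
    (e : 'I_m.+1 -> bool) (k : 'I_m.+1) : ob G :=
  if e k then sections (pull_canon w) a (f k) else pull_vertex w (f k).

Lemma mob_cell n (w : pbV n) a m (f : {omorphism 'I_m.+1 -> 'I_n.+1}) e k :
  mob phi (cell w a f e k) = vertex (act f (pull_canon w)) k.
Proof.
by rewrite vertex_act /cell; case: (e k); rewrite ?mob_sections ?mob_pull_vertex.
Qed.

Definition descend n (c : pbV n -> R) (v : vV n) : R :=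
  avg rho1 (vertex v) (fun a => ev_lift c (sections v a) v).

(** Indices are drawn at all vertices, also at those where [w] is kept, so that all terms stand
    under the same average. With [(-1) ^+ i] the prism would yield descent minus identity; the
    exponent [i.+1] reverses this. *)
Definition homotopy n (c : pbV n.+1 -> R) (w : pbV n) : R :=
  \sum_(i < n.+1) (-1) ^+ i.+1 * avg rho1 (vertex (pull_canon w)) (fun a =>
    ev_lift c (cell w a (codegeneracy i) (fun k => i < k)%N)
      (act (codegeneracy i) (pull_canon w))).

Lemma ev_lift_diff n (c : pbV n -> R) (x : 'I_n.+2 -> ob G) (v : vV n.+1) :
  (forall i, mob phi (x i) = vertex v i) ->
  ev_lift (linear_diff c) x v =
  \sum_(j < n.+2) (-1) ^+ j * ev_lift c (fun k => x (lift j k)) (act (coface j) v).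
Proof.
move=> /(pull_lift hphi)[w [<- <-]]; rewrite (ev_liftE hphi).
by apply: eq_bigr => j _; rewrite -(ev_liftE hphi).
Qed.

Lemma descend_diff n (c : pbV n -> R) :
  descend (linear_diff c) = linear_diff (descend c).
Proof.
apply/funext => v; rewrite /descend.
under [fun a => _]eq_fun do rewrite (ev_lift_diff _ (mob_sections v _)).
rewrite avg_sum; apply: eq_bigr => j _; congr (_ * _).
have -> : vertex (act (coface j) v) = fun i => vertex v (lift j i).
  by apply/funext => i; rewrite vertex_act.
rewrite avg_lift; congr (avg rho1 _ _); apply/funext => a; congr ev_lift.
by apply/funext => i; rewrite /sections vertex_act.
Qed.

(** The averaged function is the constant [c v], whatever the sections. *)
Lemma descend_pull n (c : vV n -> R) :
  descend (fun w : pbV n => c (pull_canon w)) = c.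
Proof.
apply/funext => v; rewrite /descend -[RHS](avg_cst rho1 (vertex v)).
congr (avg rho1 _ _); apply/funext => a.
have [w [wx wv]] := pull_lift hphi (mob_sections v a).
by have := ev_liftE hphi (fun w : pbV n => c (pull_canon w)) w; rewrite wx wv.
Qed.

Lemma descend_zero n : descend (0 : pbV n -> R) = 0.
Proof. exact: (descend_pull 0). Qed.

Lemma homotopy_zero n (w : pbV n) : homotopy (0 : pbV n.+1 -> R) w = 0.
Proof.
rewrite /homotopy big1// => i _; rewrite (_ : avg _ _ _ = 0) ?mulr0//.
rewrite -[RHS](avg_cst rho1 (vertex (pull_canon w))); congr (avg rho1 _ _).
apply/funext => a.
have [w' [<- <-]] := pull_lift hphi (mob_cell w a (codegeneracy i) (fun k => i < k)%N).
by rewrite (ev_liftE hphi).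
Qed.

(** The indices are natural numbers read through [inord], since [prism_sum] shifts them. The
    vertices are those of the [i]-th prism simplex, reindexed along the coface [j]. *)
Let T n (c : pbV n -> R) w a i j :=
  let f := ocomp (codegeneracy (inord i : 'I_n.+1)) (coface (inord j : 'I_n.+2)) in
  ev_lift c (cell w a f (fun k => i < lift (inord j : 'I_n.+2) k)%N)
    (act f (pull_canon w)).

Lemma homotopy_diffE n (c : pbV n -> R) w :
  homotopy (linear_diff c) w = - avg rho1 (vertex (pull_canon w)) (fun a =>
    \sum_(0 <= i < n.+1) \sum_(0 <= j < n.+2) (-1) ^+ (i + j) * T c w a i j).
Proof.
have -> : (fun a => \sum_(0 <= i < n.+1) \sum_(0 <= j < n.+2)
      (-1) ^+ (i + j) * T c w a i j) =
    fun a => \sum_(i < n.+1) (-1) ^+ i * \sum_(j < n.+2) (-1) ^+ j * T c w a i j.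
  apply/funext => a; rewrite big_mkord; apply: eq_bigr => i _.
  by rewrite big_mkord mulr_sumr; apply: eq_bigr => j _; rewrite exprD mulrA.
rewrite avg_sum -sumrN; apply: eq_bigr => i _; rewrite exprS mulN1r mulNr.
congr (- (_ * avg rho1 _ _)); apply/funext => a.
rewrite (ev_lift_diff _ (mob_cell w a _ _)); apply: eq_bigr => j _.
by rewrite /T !inord_val act_comp.
Qed.

Let D n (c : pbV n.+1 -> R) (w : pbV n.+1) a i j :=
  let f := ocomp (coface (inord j : 'I_n.+2)) (codegeneracy (inord i : 'I_n.+1)) in
  ev_lift c (cell w a f (fun k => i < k)%N) (act f (pull_canon w)).

Lemma diff_homotopyE n (c : pbV n.+1 -> R) w :
  linear_diff (homotopy c) w = - avg rho1 (vertex (pull_canon w)) (fun a =>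
    \sum_(0 <= i < n.+1) \sum_(0 <= j < n.+2) (-1) ^+ (i + j) * D c w a i j).
Proof.
have -> : (fun a => \sum_(0 <= i < n.+1) \sum_(0 <= j < n.+2)
      (-1) ^+ (i + j) * D c w a i j) =
    fun a => \sum_(i < n.+1) (-1) ^+ i * \sum_(j < n.+2) (-1) ^+ j * D c w a i j.
  apply/funext => a; rewrite big_mkord; apply: eq_bigr => i _.
  by rewrite big_mkord mulr_sumr; apply: eq_bigr => j _; rewrite exprD mulrA.
rewrite avg_sum -sumrN /linear_diff /homotopy.
under eq_bigr => j _ do rewrite mulr_sumr.
rewrite exchange_big /=; apply: eq_bigr => i _.
rewrite avg_sum mulr_sumr -sumrN; apply: eq_bigr => j _.
rewrite exprS mulN1r mulNr mulrN mulrCA; congr (- (_ * (_ * _))).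
(* The homotopy on a face averages over the vertices of that face only; [avg_lift] rewrites this as
   an average over all vertices of [w]. *)
have -> : vertex (pull_canon (act (coface j) w)) =
          fun i => vertex (pull_canon w) (lift j i).
  by apply/funext => k; rewrite vertex_act.
rewrite avg_lift; congr (avg rho1 _ _); apply/funext => a.
rewrite /D !inord_val act_comp; congr ev_lift; apply/funext => k.
by rewrite /cell /sections vertex_act.
Qed.

Lemma ev_lift_cell_eq n m (c : pbV m -> R) (w : pbV n) a
    (f f' : {omorphism 'I_m.+1 -> 'I_n.+1}) e e' :
  (forall k : 'I_m.+1, (f k : 'I_n.+1) = f' k) -> (forall k, e k = e' k) ->
  ev_lift c (cell w a f e) (act f (pull_canon w)) =
  ev_lift c (cell w a f' e') (act f' (pull_canon w)).
Proof. by move=> /omorphism_eq -> /funext ->. Qed.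

Lemma ev_lift_cell_all n (c : pbV n -> R) (w : pbV n) a
    (f : {omorphism 'I_n.+1 -> 'I_n.+1}) (e : 'I_n.+1 -> bool) :
  (forall k : 'I_n.+1, (f k : 'I_n.+1) = k) -> (forall k, e k) ->
  ev_lift c (cell w a f e) (act f (pull_canon w)) =
  ev_lift c (sections (pull_canon w) a) (pull_canon w).
Proof.
move=> fk ek; rewrite (@omorphism_eq _ _ f (oid n))// act_id; congr ev_lift.
by apply/funext => k; rewrite /cell ek.
Qed.

Lemma ev_lift_cell_none n (c : pbV n -> R) (w : pbV n) a
    (f : {omorphism 'I_n.+1 -> 'I_n.+1}) (e : 'I_n.+1 -> bool) :
  (forall k : 'I_n.+1, (f k : 'I_n.+1) = k) -> (forall k, ~~ e k) ->
  ev_lift c (cell w a f e) (act f (pull_canon w)) = c w.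
Proof.
move=> fk ek; rewrite (@omorphism_eq _ _ f (oid n))// act_id -[RHS](ev_liftE hphi).
by congr ev_lift; apply/funext => k; rewrite /cell (negPf (ek k)).
Qed.

(** Neighbouring prism simplices share the face that follows [w] up to vertex [i] and the section
    from vertex [i.+1] on. *)
Lemma T_succ n (c : pbV n -> R) w a i : (i < n)%N ->
  T c w a i.+1 i.+1 = T c w a i i.+1.
Proof.
move=> ni; apply: ev_lift_cell_eq => k; last first.
  by rewrite /= /bump inordK; lia.
apply/val_inj; rewrite /= !codegeneracy_funE /= /face_fun /= /bump !inordK; lia.
Qed.

Lemma T_first n (c : pbV n -> R) w a :
  T c w a 0 0 = ev_lift c (sections (pull_canon w) a) (pull_canon w).
Proof.
apply: ev_lift_cell_all => k; last by rewrite /= /bump inordK; lia.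
apply/val_inj; rewrite /= codegeneracy_funE /= /bump !inordK; lia.
Qed.

Lemma T_last n (c : pbV n -> R) w a : T c w a n n.+1 = c w.
Proof.
apply: ev_lift_cell_none => k; have kn := ltn_ord k.
  apply/val_inj; rewrite /= codegeneracy_funE /= /bump !inordK; lia.
by rewrite /= /bump inordK; lia.
Qed.

(** This and [T_right] are the two exchange identities between cofaces and codegeneracies; the
    position where the prism passes to the section shifts along with them. *)
Lemma T_left n (c : pbV n.+1 -> R) w a i j : (j <= i)%N -> (i < n.+1)%N ->
  T c w a i.+1 j = D c w a i j.
Proof.
move=> ji ni; apply: ev_lift_cell_eq => k; last first.
  by rewrite /= /bump inordK; lia.
apply/val_inj; rewrite /= !codegeneracy_funE /= /bump !inordK; lia.
Qed.

Lemma T_right n (c : pbV n.+1 -> R) w a i j : (i < j)%N -> (j <= n.+1)%N ->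
  T c w a i j.+1 = D c w a i j.
Proof.
move=> ij jn; apply: ev_lift_cell_eq => k; last first.
  by rewrite /= /bump inordK; lia.
apply/val_inj; rewrite /= !codegeneracy_funE /= /bump !inordK; lia.
Qed.

Lemma avg_T n (c : pbV n -> R) w :
  avg rho1 (vertex (pull_canon w)) (fun a => T c w a 0 0 - T c w a n n.+1) =
  descend c (pull_canon w) - c w.
Proof.
have -> : (fun a => T c w a 0 0 - T c w a n n.+1) =
    fun a => -1 * c w + ev_lift c (sections (pull_canon w) a) (pull_canon w).
  by apply/funext => a; rewrite T_first T_last mulN1r addrC.
by rewrite (avg_linear rho1 _ _ (fun=> c w)) avg_cst mulN1r addrC.
Qed.

Lemma homotopy0 (c : pbV 0 -> R) w :
  c w - descend c (pull_canon w) = homotopy (linear_diff c) w.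
Proof.
rewrite homotopy_diffE -[LHS]opprB; congr (- _); rewrite -avg_T; congr (avg rho1 _ _).
(* In degree 0 the prism is a single edge and its side faces are absent, so the sum over [D] is
   empty. *)
apply/funext => a; have := @prism_sum R 0 (T c w a) (fun _ _ => 0).
by rewrite [X in _ + X]big_geq// addr0 => -> // i [].
Qed.

Lemma homotopyS n (c : pbV n.+1 -> R) w :
  c w - descend c (pull_canon w) =
  homotopy (linear_diff c) w + linear_diff (homotopy c) w.
Proof.
rewrite homotopy_diffE diff_homotopyE -opprD -[LHS]opprB; congr (- _).
rewrite -avg_T -[X in _ = X + _]mul1r -avg_linear; congr (avg rho1 _ _).
apply/funext => a; rewrite mul1r; symmetry; apply: prism_sum.
- by move=> i j; exact: T_left.
- by move=> i j; exact: T_right.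
- by move=> i; exact: T_succ.
Qed.

(** * Smoothness of the descended cochains and of the homotopy *)

Lemma vertex_smooth n i : smooth_map (fun v : vV n => vertex v i).
Proof.
move=> v; apply: (@smooth_map_at_comp _ _ _ _ (Defs.proj V n)
  (fun c : nerve H n => chain_ob c i)).
  exact: smap_smooth.
exact: (@ev_smooth _ _ _ _ _ (inl i)).
Qed.

Lemma pull_canon_smooth n : smooth_map (fun w : pbV n => pull_canon w).
Proof. exact: (@ev_smooth _ _ _ _ _ false). Qed.

Lemma pull_vertex_smooth n i : smooth_map (fun w : pbV n => pull_vertex w i).
Proof.
move=> w; apply: (@smooth_map_at_comp _ _ _ _ (fun w : pbV n => pull_proj w)
  (fun c : nerve G n => chain_ob c i)).
  exact: (@ev_smooth _ _ _ _ _ true).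
exact: (@ev_smooth _ _ _ _ _ (inl i)).
Qed.

Lemma pull_comp_closed n (w : pbV n) : comp_closed w.
Proof. exact: initial_comp_closed. Qed.

Lemma total_comp_closed n (v : vV n) : comp_closed v.
Proof. exact/manifold_comp_closed/total_manifold. Qed.

Lemma descend_smooth n (c : pbV n -> R) :
  smooth_function c -> smooth_function (descend c).
Proof.
move=> sc v; apply: (avg_smooth rho1 (P := fun k z => smooth_map_at (s k) z)
  (y := fun i v => vertex v i) (F := fun v a => ev_lift c (sections v a) v)) => //.
- exact: total_comp_closed.
- by move=> i; exact: vertex_smooth.
move=> a sa; apply: (ev_lift_smooth hphi (x := fun i v => sections v a i)) => //.
- exact: total_comp_closed.
- by move=> z i; exact: mob_sections.
- move=> i; apply: (@smooth_map_at_comp _ _ _ _ (fun v => vertex v i) (s (a i))); last exact: sa.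
  exact: vertex_smooth.
- by split=> // *; exact: cvg_id.
Qed.

Lemma homotopy_smooth n (c : pbV n.+1 -> R) :
  smooth_function c -> smooth_function (homotopy c).
Proof.
move=> sc w; have cw : comp_closed w by exact: pull_comp_closed.
apply: smooth_at_sum => // i; apply: smooth_atM => //; first exact: smooth_at_cst.
apply: (avg_smooth rho1 (P := fun k z => smooth_map_at (s k) z)
  (y := fun j (w : pbV n) => vertex (pull_canon w) j)
  (F := fun (w : pbV n) a => ev_lift c (cell w a (codegeneracy i) (fun k => i < k)%N)
      (act (codegeneracy i) (pull_canon w)))) => //.
  move=> j; apply: (@smooth_map_at_comp _ _ _ _ (fun w : pbV n => pull_canon w)
    (fun v => vertex v j)).
    exact: pull_canon_smooth.
  exact: vertex_smooth.
move=> a sa; apply: (ev_lift_smooth hphi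
  (x := fun k (w : pbV n) => cell w a (codegeneracy i) (fun k => i < k)%N k)) => //.
- by move=> z k; exact: mob_cell.
- move=> k; rewrite /cell; case: (i < k)%N; last exact: pull_vertex_smooth.
  apply: (@smooth_map_at_comp _ _ _ _
    (fun w : pbV n => vertex (pull_canon w) (codegeneracy i k))
    (s (a (codegeneracy i k)))); last exact: sa.
  apply: (@smooth_map_at_comp _ _ _ _ (fun w : pbV n => pull_canon w)
    (fun v => vertex v (codegeneracy i k))).
    exact: pull_canon_smooth.
  exact: vertex_smooth.
- apply: (@smooth_map_at_comp _ _ _ _ (fun w : pbV n => pull_canon w)
    (act (codegeneracy i))).
    exact: pull_canon_smooth.
  exact: act_smooth.
Qed.

(** * Fibrewise linearity of the descended cochains and of the homotopy *)

Lemma vertex_inc n (b : nerve H n) (v : fib (fibres V n) b) :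
  vertex (inc (fibres V n) b v) = chain_ob b.
Proof. by rewrite /vertex inc_over. Qed.

Lemma avg_scalar n (y : 'I_n -> ob H) (U : lmodType R) (F : U -> ('I_n -> nat) -> R) :
  (forall a, scalar (F^~ a)) -> scalar (fun u => avg rho1 y (F u)).
Proof.
move=> lF r u v; rewrite -avg_linear; congr (avg rho1 _ _).
by apply/funext => a; rewrite lF.
Qed.

Lemma descend_cochain n (c : ambient (C_lin_pullback phi V) n) :
  cochain c -> cochain (descend c : ambient (C_lin V) n).
Proof.
move=> [sc lc]; split; first exact: descend_smooth.
(* Weights and sections depend only on the base point [b]. The identity operator is inserted to
   match the form of [ev_lift_linear]. *)
move=> b; have E v : descend c (inc (fibres V n) b v) =
    avg rho1 (chain_ob b) (fun a => ev_lift c (fun i => s (a i) (chain_ob b i))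
      (act (oid n) (inc (fibres V n) b v))).
  by rewrite /descend /sections vertex_inc act_id.
under eq_fun do rewrite E; apply: avg_scalar => // a.
by apply: (ev_lift_linear hphi) => // i; exact: sK.
Qed.

Lemma homotopy_cochain n (c : ambient (C_lin_pullback phi V) n.+1) :
  cochain c -> cochain (homotopy c : ambient (C_lin_pullback phi V) n).
Proof.
move=> [sc lc]; split; first exact: homotopy_smooth.
move=> d; rewrite /homotopy => r u v; rewrite mulr_sumr -big_split.
apply: eq_bigr => i _ /=; rewrite mulrCA -mulrDr; congr (_ * _).
pose b := nerve_map phi n d.
pose x (a : 'I_n.+1 -> nat) (k : 'I_n.+2) : ob G :=
  if (i < k)%N then s (a (codegeneracy i k)) (chain_ob b (codegeneracy i k))
  else chain_ob d (codegeneracy i k).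
(* Over a fixed [d] neither the weights nor the vertices [x a] depend on the vector [z]; only the
   degenerate simplex does, and it does so linearly. *)
have E (z : fib (fibres V n) b) : let w : pbV n := pull_inc z in
    avg rho1 (vertex (pull_canon w)) (fun a =>
      ev_lift c (cell w a (codegeneracy i) (fun k => i < k)%N)
        (act (codegeneracy i) (pull_canon w))) =
    avg rho1 (chain_ob b) (fun a =>
      ev_lift c (x a) (act (codegeneracy i) (inc (fibres V n) b z))).
  rewrite /= /cell /sections /pull_canon /= vertex_inc; congr (avg rho1 _ _).
rewrite !E; apply: (@avg_scalar _ (chain_ob b) _ (fun z a =>
  ev_lift c (x a) (act (codegeneracy i) (inc (fibres V n) b z)))) => a.
apply: (ev_lift_linear hphi) => // k.
by rewrite /x; case: ifP => _; rewrite ?sK.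
Qed.

(** [descend] is a left inverse already on cochains and commutes with the differentials, which gives
    injectivity. On cocycles the homotopy makes it a right inverse up to a coboundary, which gives
    surjectivity. Degree 0 is separate because its only coboundary is 0. *)
Lemma pull_quasi_isomorphism : quasi_isomorphism (@pull_cochain R G H phi V).
Proof.
have pull_cochainP n (c : ambient (C_lin V) n) : cochain c ->
    cochain (pull_cochain c : ambient (C_lin_pullback phi V) n).
  move=> [sc lc]; split; last by move=> d; exact: lc.
  by move=> w; have [_ sp] := pull_canon_smooth w; exact: (sp c (sc _)).
split.
  move=> n; split; first by [].
    exact: pull_cochainP.
  by move=> c _; apply/funext => w.
move=> n; split.
  move=> c c' cc cc'; case: n c c' cc cc' => [|n] c c' cc cc'.
    move=> /= cc0; have -> : c - c' = descend (pull_cochain c - pull_cochain c').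
      exact: (esym (descend_pull _)).
    by rewrite cc0 descend_zero.
  move=> [b cb db]; exists (descend b); first exact: descend_cochain.
  have /= -> : c - c' = descend (pull_cochain c - pull_cochain c').
    exact: (esym (descend_pull _)).
  by rewrite -db -descend_diff.
move=> d [cd dd]; exists (descend d).
  split; first exact: descend_cochain.
  by rewrite /= -descend_diff [linear_diff d]dd descend_zero.
case: n d cd dd => [|n] d cd dd /=.
  apply/funext => w; have := homotopy0 d w.
  by rewrite [linear_diff d]dd homotopy_zero.
exists (homotopy d); first exact: homotopy_cochain.
apply/funext => w; have := homotopyS d w.
by rewrite [linear_diff d]dd homotopy_zero add0r => <-.
Qed.

End Descent.

Theorem corollary6p12 (R : realType) (G H : lie_groupoid R)
    (phi : lie_morphism G H) (hphi : hypercover phi)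
    (V : higher_vector_bundle (nerve H)) :
  quasi_isomorphism (@pull_cochain R G H phi V).
Proof.
have [s [rho [sK srho ss rho1]]] := averaged_sections (ob_manifold H) hphi.1.
exact: (pull_quasi_isomorphism hphi V sK srho ss rho1).
Qed.
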